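(* Let $n\ge 2$, let $\alpha\in\mathbb{R}^n$ be arbitrary and let $M\in\mathfrak{S}_n^+(\mathbb{Z})$. Then (a) $\displaystyle\lim_{T\to\infty}\langle F_M\rangle_T=0$; (b) $\displaystyle\lim_{T\to\infty}\langle S_M(\,\cdot\,,\eta)\rangle_T=0$, provided that $T^{-L}<\eta\ll 1$ for some $L>0$ (that is, for every function $\eta=\eta(T)$ for which there are constants $L,C>0$ with $T^{-L}<\eta(T)\le C$).
   Context: $\mathfrak{S}_n^+(\mathbb{Z})$ is the set of positive definite symmetric $n\times n$ matrices with integer entries. For $M\in\mathfrak{S}_n^+(\mathbb{Z})$ put $Q_M(x)=\langle Mx,x\rangle$, $E^M=\{x\in\mathbb{R}^n:Q_M(x)\le 1\}$, and let $|E^M|$ be its volume. For $t>0$ let $N_M(t)=\#\{m\in\mathbb{Z}^n:Q_M(m-\alpha)\le t^2\}$, $$F_M(t)=\frac{N_M(t)-|E^M|t^n}{t^{(n-1)/2}},\qquad S_M(t,\eta)=\frac{N_M(t+\eta)-N_M(t)-|E^M|((t+\eta)^n-t^n)}{\sqrt{\eta}\,t^{(n-1)/2}}\quad(\eta>0).$$ Fix a nonnegative $\mu\in C_c^\infty(\mathbb{R})$ supported in $(0,\infty)$ with $\int\mu=1$. For $f\in L^1_{\rm loc}(\mathbb{R})$ and $T>0$ set $\langle f\rangle_T=\int_{\mathbb{R}}f(t)\,\frac1T\mu\left(\frac tT\right)dt$. *)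

(* Defs.v *)
From HB Require Import structures.
From mathcomp Require Import all_boot all_order all_algebra finmap.
From mathcomp Require Import all_classical all_reals all_analysis.

Set Implicit Arguments.
Unset Strict Implicit.
Unset Printing Implicit Defensive.

Import Order.TTheory GRing.Theory Num.Theory.
Import numFieldNormedType.Exports.

Local Open Scope classical_set_scope.
Local Open Scope ring_scope.

(* Lebesgue measure on R^n, as the n-fold product of one-dimensional Lebesgue
   measure.  It lives on n.-tuple R, which carries the product sigma-algebra;
   the n.+1-dimensional measure is the image of the library product
   lebesgue_measure \x (n-dimensional measure) under (x, s) |-> x :: s. *)
Section tuple_lebesgue.
Context (R : realType).
Local Notation tupleR n := (n.-tuple (measurableTypeR R)).

Definition cons_pair n (p : measurableTypeR R * tupleR n) : tupleR n.+1 :=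
  [the n.+1.-tuple _ of p.1 :: p.2].

Lemma measurable_cons_pair n : measurable_fun setT (@cons_pair n).
Proof. exact: measurable_cons. Qed.

Section cons_lebesgue.
Local Open Scope ereal_scope.
Context n (m : {sigma_finite_measure set (tupleR n) -> \bar R}).

Definition cons_lebesgue : set (tupleR n.+1) -> \bar R :=
  pushforward (lebesgue_measure \x m) (@cons_pair n).

Let measurable_preimage (A : set (tupleR n.+1)) :
  measurable A -> measurable (@cons_pair n @^-1` A).
Proof.
by move=> mA; rewrite -[X in measurable X]setTI; exact: measurable_cons_pair.
Qed.

Let cons_lebesgue0 : cons_lebesgue set0 = 0.
Proof. by rewrite /cons_lebesgue /pushforward preimage_set0 measure0. Qed.

Let cons_lebesgue_ge0 A : 0 <= cons_lebesgue A.
Proof. exact: (measure_ge0 (lebesgue_measure \x m)). Qed.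

Let cons_lebesgue_sigma_additive : semi_sigma_additive cons_lebesgue.
Proof.
move=> F mF tF mUF; rewrite /cons_lebesgue /pushforward preimage_bigcup.
apply: measure_semi_sigma_additive.
- by move=> k; exact: measurable_preimage.
- apply/trivIsetP => /= i j _ _ ij; rewrite -preimage_setI.
  by move/trivIsetP : tF => /(_ _ _ _ _ ij) ->//; rewrite preimage_set0.
- by rewrite -preimage_bigcup; exact: measurable_preimage.
Qed.

HB.instance Definition _ := isMeasure.Build _ _ _ cons_lebesgue
  cons_lebesgue0 cons_lebesgue_ge0 cons_lebesgue_sigma_additive.

Let cons_lebesgue_sigma_finite : sigma_finite setT cons_lebesgue.
Proof.
have /sigma_finiteP[F [FT ndF Foo]] := sigma_finiteT (@lebesgue_measure R).
have /sigma_finiteP[G [GT ndG Goo]] := sigma_finiteT m.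
pose g (t : tupleR n.+1) : measurableTypeR R * tupleR n :=
  (thead t, [tuple of behead t]).
have mg : measurable_fun setT g.
  apply/measurable_fun_pair => /=.
    exact: measurable_tnth.
  exact: measurable_behead.
have gK p : g (cons_pair p) = p.
  by case: p => x s; congr pair; exact/val_inj.
exists (fun i => g @^-1` (F i `*` G i)).
  rewrite -preimage_bigcup; apply/seteqP; split => // t _ /=.
  have [i _ Fi] : (\bigcup_i F i) (g t).1 by rewrite -FT.
  have [j _ Gj] : (\bigcup_i G i) (g t).2 by rewrite -GT.
  exists (maxn i j) => //; split.
    by move: Fi; exact/subsetPset/ndF/leq_maxl.
  by move: Gj; exact/subsetPset/ndG/leq_maxr.
move=> i; have [mFi Fioo] := Foo i; have [mGi Gioo] := Goo i; split.
  by rewrite -[X in measurable X]setTI; apply: mg => //; exact: measurableX.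
rewrite /cons_lebesgue /pushforward -comp_preimage.
rewrite (_ : g \o _ = id); last by apply/funext => p; exact: gK.
by rewrite /= product_measure1E// lte_mul_pinfty// ge0_fin_numE.
Qed.

HB.instance Definition _ := Measure_isSigmaFinite.Build _ _ _ cons_lebesgue
  cons_lebesgue_sigma_finite.

End cons_lebesgue.

Fixpoint tuple_lebesgue n :
    {sigma_finite_measure set (tupleR n) -> \bar R} :=
  match n with
  | 0 => [the {sigma_finite_measure set (tupleR 0) -> \bar R}
            of \d_([tuple] : tupleR 0)]
  | n'.+1 => [the {sigma_finite_measure set (tupleR n'.+1) -> \bar R}
                of cons_lebesgue (tuple_lebesgue n')]
  end.

Lemma tuple_lebesgue_box n (A : 'I_n -> set (measurableTypeR R)) :
  (forall i, measurable (A i)) ->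
  tuple_lebesgue n [set t | forall i, A i (tnth t i)] =
  (\prod_(i < n) lebesgue_measure (A i))%E.
Proof.
elim: n A => [|n IH] A mA.
  by rewrite big_ord0 /= /dirac indicE mem_set// => -[].
rewrite big_ord_recl -(IH (fun i => A (lift ord0 i)))//.
rewrite -product_measure1E//; last first.
  rewrite (_ : [set t | _] = \bigcap_(i in [set: 'I_n])
      ((fun t : tupleR n => tnth t i) @^-1` A (lift ord0 i))); last first.
    by apply/seteqP; split => t /= h i => [_|]; exact: h.
  apply: fin_bigcap_measurable; first exact: finite_finset.
  by move=> i _; rewrite -[X in measurable X]setTI; exact: measurable_tnth.
rewrite /= /cons_lebesgue /pushforward; congr (_ _).
apply/seteqP; split => -[x s] /=.
  move=> h; split; first exact: (h ord0).
  by move=> i; have := h (lift ord0 i); rewrite tnthS.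
by move=> [hx hs] i; case: (unliftP ord0 i) => [j ->|->//]; rewrite tnthS.
Qed.

End tuple_lebesgue.

Section definitions.
Context (R : realType) (n : nat).
Implicit Types (M : 'M[int]_n) (x y alpha : 'cV[R]_n) (t eta T : R).

Definition volume (A : set 'cV[R]_n) : R :=
  fine (tuple_lebesgue R n [set s | A (\col_i tnth s i)]).

Definition inner x y : R := \sum_i x i 0 * y i 0.

Definition quadform M x : R := inner (map_mx intr M *m x) x.

Definition posdef_sym M : Prop :=
  M^T = M /\ forall x, x != 0 -> 0 < quadform M x.

Definition ellipsoid M : set 'cV[R]_n := [set x | quadform M x <= 1].

(* fset_set is the empty set on infinite sets; for positive definite M the set
   counted here is finite. *)
Definition lattice_count M alpha t : nat :=
  #|` fset_set [set m : 'cV[int]_n |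
                 quadform M (map_mx intr m - alpha) <= t ^+ 2] |.

Definition FM M alpha t : R :=
  ((lattice_count M alpha t)%:R - volume (ellipsoid M) * t ^+ n) /
  t `^ ((n%:R - 1) / 2).

Definition SM M alpha t eta : R :=
  ((lattice_count M alpha (t + eta))%:R - (lattice_count M alpha t)%:R
     - volume (ellipsoid M) * ((t + eta) ^+ n - t ^+ n)) /
  (Num.sqrt eta * t `^ ((n%:R - 1) / 2)).

End definitions.

Section averages.
Context (R : realType).
Implicit Types (mu f : R -> R) (T : R).

Definition smooth f : Prop := forall k x, derivable (derive1n k f) x 1.

Definition tsupport f : set R := closure [set x | f x != 0].

(* A nonnegative function in C_c^oo(R), supported in ]0, +oo[, of integral 1. *)
Definition averaging_density mu : Prop :=
  [/\ forall x, 0 <= mu x,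
      smooth mu,
      compact (tsupport mu),
      tsupport mu `<=` [set x | 0 < x] &
      (\int[lebesgue_measure]_x (mu x)%:E)%E = 1%:E].

Definition average mu f T : R :=
  \int[lebesgue_measure]_t (f t * (T^-1 * mu (t / T))).

End averages.

(* Main.v *)
(** Integrating against the weight exchanges sum and integral: the average of the
    counting function becomes a sum over the shifted lattice of one fixed smooth
    compactly supported function of |m - alpha|_M / T.  As a function of the shift
    alpha this sum is periodic, and each derivative along a coordinate gains a
    factor 1/T.  A derivative of positive order of a periodic function
    vanishes somewhere on each period (Rolle), so it is controlled by the next
    one; hence the sum depends on alpha only up to O(T^-K), for every K.  Its mean
    over a unit cube of shifts is exactly the volume term, because the mean of
    N_M(t) over such a cube is |E^M| t^n.  So the smoothed discrepancy is O(T^-K),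
    uniformly in an additional shift of t by eta, which also absorbs the factor
    eta^(-1/2) <= T^(L/2) in part (b). *)

From HB Require Import structures.
Require Import Defs.
From mathcomp Require Import all_boot all_order all_algebra.
From mathcomp Require Import finmap ring lra zify.
From mathcomp Require Import all_classical all_reals all_analysis.
From mathcomp Require Import measurable_realfun.

Set Implicit Arguments.
Unset Strict Implicit.
Unset Printing Implicit Defensive.

Import Order.TTheory GRing.Theory Num.Theory.
Import numFieldNormedType.Exports.
Local Open Scope classical_set_scope.
Local Open Scope ring_scope.

(** * Families of smooth functions *)

(** The shift moves along one coordinate axis at a time, so only one-variable calculus occurs. On a
    line parallel to an axis the norm |x|_M is sqrt(y^2 + c), where y is arc length and c is the
    squared distance of the line from the origin. The lattice points lie on many such lines and c
    has no positive lower bound, so derivative bounds must be uniform down to c = 0, where this root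
    is not differentiable. The singularity is harmless because mu vanishes near 0: so does the
    weight g(u) = u^(-s) mu(u) with s = (n-1)/2, and the function summed over the lattice, a tail
    integral of g, is constant near the origin. The sum has O(T^n) terms, so a decay T^(-K) costs n
    further derivatives. Shifting t by eta becomes, after division by T, a shift by th = eta/T,
    which lies in [0, 1] for large T and is one more index of the same uniform families. Part (b)
    thus needs no cancellation between the two counts: each discrepancy separately is far smaller
    than sqrt(eta). *)

Lemma is_derive_sum_seq (R : realType) (J : Type) (S : seq J)
    (f df : J -> R -> R) (x : R) :
  (forall j, is_derive x (1 : R) (f j) (df j x)) ->
  is_derive x (1 : R) (fun t => \sum_(j <- S) f j t) (\sum_(j <- S) df j x).
Proof.
move=> fdf; elim: S => [|j S IH].
  rewrite big_nil (_ : (fun _ => _) = cst 0); first exact: is_derive_cst.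
  by apply/funext => t; rewrite big_nil.
rewrite big_cons (_ : (fun _ => _) = f j \+ (fun t => \sum_(j <- S) f j t)).
  exact: is_deriveD.
by apply/funext => t; rewrite big_cons.
Qed.

Lemma is_derive_affine (R : realType) (f : R -> R) (df y r s : R) :
  is_derive (y + r * s) (1 : R) f df ->
  is_derive s (1 : R) (fun t => f (y + r * t)) (r * df).
Proof.
move=> fdf.
have h : is_derive s (1 : R) (fun t => y + r * t) r.
  have -> : (fun t => y + r * t) = cst y \+ r \*: id by [].
  by apply: is_derive_eq; rewrite add0r; exact: mulr1.
have := @is_derive1_comp R f (fun t => y + r * t) s df r fdf h.
by rewrite /= mulrC.
Qed.

Lemma MVT01_bound (R : realType) (f df : R -> R) (K s t : R) :
  (forall x, is_derive x (1 : R) f (df x)) ->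
  (forall x, 0 <= x <= 1 -> `|df x| <= K) ->
  0 <= s <= 1 -> 0 <= t <= 1 -> `|f s - f t| <= K.
Proof.
move=> fdf dfK.
wlog ts : s t / t <= s.
  move=> h s01 t01; have [ts|/ltW st] := leP t s; first exact: h.
  by rewrite distrC; exact: h.
move=> /andP[s0 s1] /andP[t0 t1].
have cf : {within `[t, s], continuous f}.
  by apply: derivable_within_continuous => x _; case: (fdf x).
have [c] := MVT_segment ts (fun x _ => fdf x) cf.
rewrite in_itv/= => /andP[tc cs] ->; rewrite normrM.
have K0 : 0 <= K by apply: le_trans (dfK 0 _); rewrite ?lexx ?ler01.
have c01 : 0 <= c <= 1 by apply/andP; split; lra.
rewrite -[leRHS]mulr1 ler_pM// ?dfK//.
by rewrite ger0_norm; lra.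
Qed.

Section smooth_family.
Context (R : realType) (I : Type) (D : I -> Prop) (Z : I -> R -> Prop).
Implicit Types F G : I -> R -> R.

(* Families (F i)_{D i} of functions whose first k derivatives are bounded,
   uniformly in i, and vanish at the points y with Z i y. *)
Fixpoint smooth_family k F : Prop :=
  [/\ exists B : R, forall i y, D i -> `|F i y| <= B,
      forall i y, D i -> Z i y -> F i y = 0 &
      if k is k'.+1 then
        exists2 F' : I -> R -> R,
          forall i (y : R), D i -> is_derive y (1 : R) (F i) (F' i y) &
                    smooth_family k' F'
      else True].

Lemma smooth_familyW k F : smooth_family k.+1 F -> smooth_family k F.
Proof.
elim: k F => [|k IH] F; first by case.
by case=> ? ? [F' dF] /IH ?; split => //; exists F'.
Qed.

Lemma smooth_family_le k l F :
  (k <= l)%N -> smooth_family l F -> smooth_family k F.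
Proof.
move=> /subnK <-; elim: (l - k)%N => // m IH.
by rewrite addSn => /smooth_familyW.
Qed.

Lemma smooth_family_eq k F G : (forall i y, D i -> F i y = G i y) ->
  smooth_family k F -> smooth_family k G.
Proof.
move=> FG.
have E i : D i -> F i = G i by move=> Di; apply/funext => y; exact: FG.
case: k => [|k] [[B FB] FZ dF].
  split=> //; first by exists B => i y Di; rewrite -FG// FB.
  by move=> i y Di Zi; rewrite -FG// FZ.
split; first by exists B => i y Di; rewrite -FG// FB.
  by move=> i y Di Zi; rewrite -FG// FZ.
by case: dF => F' dF ?; exists F' => // i y Di; rewrite -E//; exact: dF.
Qed.

Lemma smooth_familyD k F G : smooth_family k F -> smooth_family k G ->
  smooth_family k (fun i y => F i y + G i y).
Proof.
elim: k F G => [|k IH] F G [[B FB] FZ dF] [[C GC] GZ dG]; split=> //.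
- exists (B + C) => i y Di; apply: le_trans (ler_normD _ _) _.
  by rewrite lerD ?FB ?GC.
- by move=> i y Di Zi; rewrite FZ// GZ// addr0.
- exists (B + C) => i y Di; apply: le_trans (ler_normD _ _) _.
  by rewrite lerD ?FB ?GC.
- by move=> i y Di Zi; rewrite FZ// GZ// addr0.
- case: dF dG => F' dF sF [G' dG sG].
  exists (fun i y => F' i y + G' i y); last exact: IH.
  by move=> i y Di; have := dF i y Di; have := dG i y Di => ? ?;
     exact: is_deriveD.
Qed.

Lemma smooth_familyZ k (a : R) F : smooth_family k F ->
  smooth_family k (fun i y => a * F i y).
Proof.
elim: k F => [|k IH] F [[B FB] FZ dF]; split=> //.
- by exists (`|a| * B) => i y Di; rewrite normrM ler_wpM2l ?FB.
- by move=> i y Di Zi; rewrite FZ// mulr0.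
- by exists (`|a| * B) => i y Di; rewrite normrM ler_wpM2l ?FB.
- by move=> i y Di Zi; rewrite FZ// mulr0.
- case: dF => F' dF sF; exists (fun i y => a * F' i y); last exact: IH.
  by move=> i y Di; have ? := dF i y Di; exact: is_deriveZ.
Qed.

(* The sum over S is a function of s whose values at 0 and 1 agree, and so do
   those of its derivatives; by Rolle, each derivative of positive order
   vanishes somewhere on [0, 1], and hence is bounded by the next one. *)
Lemma periodic_sum_oscillation k F : smooth_family k.+1 F ->
  exists2 B : R, 0 <= B &
  forall (J : Type) (S : seq J) (i : J -> I) (y : J -> R) (r : R),
    0 < r -> (forall j, D (i j)) ->
    (forall G, (forall i y, D i -> Z i y -> G i y = 0) ->
       \sum_(j <- S) G (i j) (y j) = \sum_(j <- S) G (i j) (y j + r)) ->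
    forall s t : R, 0 <= s <= 1 -> 0 <= t <= 1 ->
    `|\sum_(j <- S) F (i j) (y j + r * s) -
      \sum_(j <- S) F (i j) (y j + r * t)| <= (size S)%:R * B * r ^+ k.+1.
Proof.
have dsum F0 F' (J : Type) (S : seq J) (i : J -> I) (y : J -> R) (r x : R) :
    (forall i (y : R), D i -> is_derive y (1 : R) (F0 i) (F' i y)) ->
    (forall j, D (i j)) ->
    is_derive x (1 : R) (fun s => \sum_(j <- S) F0 (i j) (y j + r * s))
      (r * \sum_(j <- S) F' (i j) (y j + r * x)).
  move=> dF Di; rewrite mulr_sumr.
  apply: (@is_derive_sum_seq R J S (fun j s => F0 (i j) (y j + r * s))
     (fun j s => r * F' (i j) (y j + r * s))) => j.
  exact/is_derive_affine/dF.
elim: k F => [|k IH] F.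
  case=> _ _ [F' dF [[B F'B] _ _]]; exists `|B| => // J S i y r /ltW r0 Di per s t.
  apply: (@MVT01_bound R (fun s => \sum_(j <- S) F (i j) (y j + r * s))
    (fun s => r * \sum_(j <- S) F' (i j) (y j + r * s))) => x.
    exact: dsum.
  move=> _; rewrite normrM ger0_norm// expr1 mulrC ler_wpM2r//.
  apply: le_trans (ler_norm_sum _ _ _) _.
  apply: (@le_trans _ _ (\sum_(j <- S) `|B|)).
    by apply: ler_sum => j _; apply: le_trans (ler_norm _); exact: F'B.
  by rewrite big_const_seq count_predT iter_addr addr0 mulr_natl.
case=> FB FZ [F' dF sF']; have [B B0 hB] := IH _ sF'.
exists B => // J S i y r r0 Di per s t.
pose Q s := \sum_(j <- S) F (i j) (y j + r * s).
pose Q' s := \sum_(j <- S) F' (i j) (y j + r * s).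
apply: (@MVT01_bound R Q (fun s => r * Q' s)) => x; first exact: dsum.
move=> x01; rewrite normrM gtr0_norm// exprS mulrCA ler_wpM2l ?(ltW r0)// -/(Q' x).
have dQ (z : R) : is_derive z (1 : R) Q (r * Q' z) by exact: dsum.
have Q01 : Q 0 = Q 1.
  rewrite /Q; under eq_bigr do rewrite mulr0 addr0.
  by under [in RHS]eq_bigr do rewrite mulr1; exact: per.
have dvQ (z : R) : derivable Q z 1 by case: (dQ z).
have cQ : {within `[0, 1], continuous Q}.
  by apply: derivable_within_continuous => z _; exact: dvQ.
have [c c01 dQc] := Rolle ltr01 (fun z _ => dvQ z) cQ Q01.
have Qc0 : Q' c = 0.
  have [_] := dQ c.
  case: dQc => _ -> /esym/eqP.
  by rewrite mulf_eq0 gt_eqF//= => /eqP.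
have c01' : 0 <= c <= 1 by move: c01; rewrite in_itv/= => /andP[/ltW-> /ltW->].
(* [per] is assumed for every G vanishing on Z, so it serves the derivative F' as well; this lets
   the induction descend. *)
by have := hB J S i y r r0 Di per x c x01 c01'; rewrite -/(Q' x) -/(Q' c)
  Qc0 subr0.
Qed.

End smooth_family.

(** * Radial profiles along lines *)

Lemma is_derive_id_fun (R : realType) (x : R) :
  is_derive x (1 : R) (fun y : R => y) 1.
Proof. exact: is_derive_id. Qed.

Lemma is_derive_mul_fun (R : realType) (f g : R -> R) (x df dg D : R) :
  is_derive x (1 : R) f df -> is_derive x (1 : R) g dg ->
  D = df * g x + f x * dg -> is_derive x (1 : R) (fun y => f y * g y) D.
Proof.
move=> hf hg ->; have := is_deriveM hf hg.
rewrite /GRing.scale/= addrC [g x * _]mulrC; exact.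
Qed.

Lemma is_derive_add_fun (R : realType) (f g : R -> R) (x df dg D : R) :
  is_derive x (1 : R) f df -> is_derive x (1 : R) g dg ->
  D = df + dg -> is_derive x (1 : R) (fun y => f y + g y) D.
Proof. by move=> hf hg ->; exact: is_deriveD. Qed.

Lemma is_derive_exp_fun (R : realType) (f : R -> R) n (x df D : R) :
  is_derive x (1 : R) f df ->
  D = n%:R * f x ^+ n.-1 * df -> is_derive x (1 : R) (fun y => f y ^+ n) D.
Proof.
move=> hf ->; have := is_deriveX n hf.
rewrite (_ : f ^+ n = fun y => f y ^+ n)//; apply/funext => y.
by elim: n => [|n IH]; rewrite ?expr0// !exprS -IH.
Qed.

Lemma is_derive_comp_fun (R : realType) (f g : R -> R) (x df dg D : R) :
  is_derive (g x) (1 : R) f df -> is_derive x (1 : R) g dg ->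
  D = df * dg -> is_derive x (1 : R) (fun y => f (g y)) D.
Proof. by move=> hf hg ->; exact: (is_derive1_comp hf hg). Qed.

(** * Functions supported in a fixed interval *)

Section bumps.
Context (R : realType) (d X : R).
Implicit Types (h g mu : R -> R).

Definition off_support (_ : unit) (u : R) := ~ (d <= u <= X).

(** A family with a single member, so that the closure lemmas for families apply to one function. *)
Definition bump k h :=
  smooth_family (fun _ : unit => True) off_support k (fun=> h).

Lemma bump0 k h u : bump k h -> ~ (d <= u <= X) -> h u = 0.
Proof. by case: k => [|k] [_ h0 _] hu; exact: (h0 tt). Qed.

Lemma bump_bounded k h : bump k h -> exists2 B : R, 0 <= B & forall u, `|h u| <= B.
Proof.
by case: k => [|k] [[B hB] _ _]; exists `|B| => // u;
  apply: le_trans (ler_norm _); exact: (hB tt).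
Qed.

Lemma bump_deriv k h : bump k.+1 h ->
  exists2 h' : R -> R, forall u : R, is_derive u (1 : R) h (h' u) & bump k h'.
Proof.
case=> _ _ [h' dh sh]; exists (h' tt) => [u|]; first exact: (dh tt).
by apply: smooth_family_eq sh => -[].
Qed.

Lemma derivable_bounded h : (forall u, derivable h u 1) ->
  (forall u, ~ (d <= u <= X) -> h u = 0) ->
  exists B : R, forall u, `|h u| <= B.
Proof.
move=> dh h0; have [dX|Xd] := leP d X; last first.
  exists 0 => u; rewrite h0 ?normr0// => /andP[du uX].
  by have := lt_le_trans Xd (le_trans du uX); rewrite ltxx.
have ch : {within `[d, X], continuous h}.
  by apply: derivable_within_continuous => u _; exact: dh.
have [a _ ha] := EVT_max dX ch; have [b _ hb] := EVT_min dX ch.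
exists (`|h a| + `|h b|) => u.
have [uin|uout] := boolP (u \in `[d, X]); last first.
  by rewrite h0 ?normr0 ?addr_ge0//; apply/negP; move: uout; rewrite in_itv.
rewrite ler_norml; have := ler_norm (h a); have := ler_norm (- h b).
rewrite normrN; have := normr_ge0 (h a); have := normr_ge0 (h b).
have := ha _ uin; have := hb _ uin => *; apply/andP; split; lra.
Qed.

Lemma near_off_support (u : R) : ~ (d <= u <= X) ->
  \forall z \near u, ~ (d <= z <= X).
Proof.
move=> /negP; rewrite negb_and -!ltNge => /orP[ud|Xu].
  near=> z; have zd : z < d by near: z; exact: lt_nbhsl.
  by rewrite leNgt zd.
near=> z; have zd : X < z by near: z; exact: lt_nbhsr.
by rewrite [z <= X]leNgt zd andbF.
Unshelve. all: by end_near. Qed.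

Lemma is_derive_off_support h (u : R) :
  (forall u, ~ (d <= u <= X) -> h u = 0) -> ~ (d <= u <= X) ->
  is_derive u (1 : R) h 0.
Proof.
move=> h0 /near_off_support uoff.
have := is_derive_cst (0 : R) u (1 : R); apply: near_eq_is_derive.
by apply: filterS uoff => z zoff; rewrite h0.
Qed.

Lemma derive1n_off_support mu : (forall u, ~ (d <= u <= X) -> mu u = 0) ->
  forall j u, ~ (d <= u <= X) -> derive1n j mu u = 0.
Proof.
move=> mu0; elim=> [//|j IH] u uoff; rewrite derive1nS derive1E.
by have [_] := is_derive_off_support IH uoff.
Qed.

(** The power is singular only at 0, where mu vanishes since d > 0. Differentiation yields the pairs
    (s - 1, j) and (s, j + 1), hence the induction over all j and s at once. *)
Lemma bump_powR_mul k j (s : R) mu : 0 < d -> smooth mu ->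
  (forall u, ~ (d <= u <= X) -> mu u = 0) ->
  bump k (fun u => u `^ s * derive1n j mu u).
Proof.
move=> d0 smu mu0; have muj0 := derive1n_off_support mu0.
have der l (r u : R) : is_derive u (1 : R) (fun u => u `^ r * derive1n l mu u)
    (r * (u `^ (r - 1) * derive1n l mu u) + u `^ r * derive1n l.+1 mu u).
  have [/andP[du _]|uoff] := pselect (d <= u <= X); last first.
    rewrite !muj0// !mulr0 addr0; apply: is_derive_off_support uoff => z zoff.
    by rewrite muj0// mulr0.
  have u0 : 0 < u by exact: lt_le_trans du.
  have h1 := is_derive1_powR r u0.
  have h2 : is_derive u (1 : R) (derive1n l mu) (derive1n l.+1 mu u).
    rewrite derive1nS derive1E; exact: derivableP.
  by apply: (is_derive_mul_fun h1 h2); rewrite mulrA.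
have bnd l (r : R) : exists B : R, forall u, `|u `^ r * derive1n l mu u| <= B.
  apply: derivable_bounded => [u|u uoff]; first by case: (der l r u).
  by rewrite muj0// mulr0.
elim: k j s => [|k IH] j s; (split;
  [by have [B hB] := bnd j s; exists B|
   by move=> ? u ? ?; rewrite muj0// mulr0|]) => //.
exists (fun _ u => s * (u `^ (s - 1) * derive1n j mu u) +
                   u `^ s * derive1n j.+1 mu u); first by move=> *; exact: der.
by apply: smooth_familyD; [apply: smooth_familyZ|]; exact: IH.
Qed.

End bumps.

Section radial_profiles.
Context (R : realType) (d X : R).
Hypothesis d0 : 0 < d.

(* An index (c, th) stands for the restriction of the function
   x |-> h (|x| - th) to a line at squared distance c from the origin, y being
   the arc length measured from the foot of the perpendicular. *)
Definition line_ok (i : R * R) := 0 <= i.1 /\ 0 <= i.2 <= 1.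

Definition radius (i : R * R) (y : R) := Num.sqrt (y ^+ 2 + i.1).

(** The added 1 absorbs the shift: beyond X + 1, [radius i y - i.2] exceeds X for every [i.2] in
    [0, 1]. *)
Definition far (i : R * R) (y : R) := X + 1 < radius i y.

Lemma radius_ge0 i y : 0 <= radius i y. Proof. exact: sqrtr_ge0. Qed.

Lemma norm_le_radius i y : line_ok i -> `|y| <= radius i y.
Proof.
move=> [i0 _]; rewrite -sqrtr_sqr ler_sqrt ?addr_ge0 ?sqr_ge0//.
by rewrite lerDl.
Qed.

Lemma is_derive_radius i (y : R) : line_ok i -> 0 < radius i y ->
  is_derive y (1 : R) (radius i) (y * (radius i y)^-1).
Proof.
move=> ok; rewrite sqrtr_gt0 => yi0.
have h1 := is_derive1_sqrt yi0.
have h2 : is_derive y (1 : R) (fun y => y ^+ 2 + i.1) (2 * y).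
  have a2 : is_derive y (1 : R) (fun y => y ^+ 2) (2 * y).
    apply: (is_derive_exp_fun (n := 2) (is_derive_id_fun y)).
    by rewrite expr1 mulr1.
  by apply: (is_derive_add_fun a2 (is_derive_cst i.1 y (1 : R))); rewrite addr0.
suff : is_derive y (1 : R) (fun y => Num.sqrt (y ^+ 2 + i.1))
  (y * (radius i y)^-1) by [].
apply: (is_derive_comp_fun (g := fun y => y ^+ 2 + i.1) h1 h2).
rewrite -/(radius i y).
by field; rewrite gt_eqF// sqrtr_gt0.
Qed.

Lemma near_radius_lt i (y : R) : radius i y < d ->
  \forall z \near y, radius i z < d.
Proof.
have cr : continuous (radius i).
  move=> z; suff : {for z, continuous (Num.sqrt \o (fun y => y ^+ 2 + i.1))} by [].
  apply: continuous_comp; last exact: sqrt_continuous.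
  apply: cvgD; last exact: cvg_cst.
  exact: exprn_continuous.
by move=> yd; have := cr y _ (lt_nbhsl yd).
Qed.

Lemma off_of_radius i y : line_ok i -> radius i y < d ->
  ~ (d <= radius i y - i.2 <= X).
Proof. by case=> _ /andP[i0 _] rd /andP[dr _]; lra. Qed.

Lemma off_of_far i y : line_ok i -> far i y -> ~ (d <= radius i y - i.2 <= X).
Proof. by rewrite /far => -[_ /andP[_ i1]] rd /andP[_ dr]; lra. Qed.

(** Since r' = y / r for the radius r, this class of products is closed under differentiation up to
    linear combinations, which is why p and q are free. Where h does not vanish, d <= r <= X + 1 and
    |y| <= r, whence bounds independent of the line; for r < d the product is locally 0. *)
Lemma profile_smooth k p q (h : R -> R) : bump d X k h ->
  smooth_family line_ok far k
    (fun i y => y ^+ p * (radius i y)^-1 ^+ q * h (radius i y - i.2)).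
Proof.
move: p q h; have bnd p q (h : R -> R) : bump d X 0 h -> exists B : R, forall i y,
    line_ok i -> `|y ^+ p * (radius i y)^-1 ^+ q * h (radius i y - i.2)| <= B.
  move=> sh; have [B B0 hB] := bump_bounded sh.
  exists ((`|X| + 1) ^+ p * d^-1 ^+ q * B) => i y ok.
  have [hin|/(bump0 sh) ->] := pselect (d <= radius i y - i.2 <= X); last first.
    rewrite mulr0 normr0; apply: mulr_ge0 => //; apply: mulr_ge0.
      by apply: exprn_ge0; rewrite addr_ge0.
    by apply: exprn_ge0; rewrite invr_ge0 ltW.
  have dr : d <= radius i y by case: ok => _; case/andP: hin; lra.
  have r0 : 0 < radius i y by exact: lt_le_trans dr.
  rewrite !normrM !normrX; apply: ler_pM => //.
  rewrite ler_pM ?exprn_ge0//.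
    rewrite lerXn2r ?nnegrE ?addr_ge0//.
    apply: le_trans (norm_le_radius y ok) _.
    by case: ok => _; case/andP: hin; have := ler_norm X; lra.
  rewrite lerXn2r ?nnegrE ?invr_ge0 ?(ltW d0)//.
  by rewrite ger0_norm ?invr_ge0 ?radius_ge0// lef_pV2.
elim: k => [|k IH] p q h sh; (split;
  [apply: bnd; exact: smooth_family_le sh|
   by move=> i y ok /off_of_far /(bump0 sh)->//; rewrite mulr0|]) => //.
have [h' dh sh'] := bump_deriv sh.
exists (fun i y =>
  p%:R * (y ^+ p.-1 * (radius i y)^-1 ^+ q * h (radius i y - i.2)) +
  (- q%:R * (y ^+ p.+1 * (radius i y)^-1 ^+ q.+2 * h (radius i y - i.2)) +
   y ^+ p.+1 * (radius i y)^-1 ^+ q.+1 * h' (radius i y - i.2))).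
  move=> i y ok; have [rd|dr] := ltP (radius i y) d.
    rewrite (bump0 sh (off_of_radius ok rd)) (bump0 sh' (off_of_radius ok rd)).
    rewrite !mulr0 !addr0.
    have := is_derive_cst (0 : R) y (1 : R); apply: near_eq_is_derive.
    apply: filterS (near_radius_lt rd) => z zd /=.
    by rewrite (bump0 sh (off_of_radius ok zd)) mulr0.
  have r0 : 0 < radius i y by exact: lt_le_trans dr.
  have dr1 := is_derive_radius ok r0.
  have dV := is_deriveV (lt0r_neq0 r0) dr1.
  have dVq := is_derive_exp_fun (n := q) dV erefl.
  have dp := is_derive_exp_fun (n := p) (is_derive_id_fun y) erefl.
  have dr2 := is_derive_add_fun dr1 (is_derive_cst (- i.2) y (1 : R)) erefl.
  have dH := is_derive_comp_fun (dh _) dr2 erefl.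
  apply: (is_derive_mul_fun (is_derive_mul_fun dp dVq erefl) dH).
  rewrite /GRing.scale/= mulr1 addr0 exprSr.
  case: q {dVq} => [|q]; rewrite /= ?mul0r ?mulr0 ?oppr0 ?mul0r ?add0r ?addr0 ?expr0.
    by rewrite !expr1 !mulr1; ring.
  rewrite [_ ^+ q.+3]exprSr [_ ^+ q.+2]exprSr [_ ^+ q.+1]exprSr -exprVn.
  by rewrite expr2 !mulNr; ring.
by apply: smooth_familyD; [|apply: smooth_familyD];
  rewrite ?smooth_familyZ//; [..|exact: IH];
  apply: smooth_familyZ; apply: IH; exact: smooth_familyW.
Qed.

(** H need not vanish left of d, so it is no bump itself; but its composite with the radius has
    derivative -(y / r) g(r - th), a profile with p = q = 1. *)
Lemma primitive_profile_smooth k (H g : R -> R) : bump d X k g ->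
  (exists B : R, forall u, `|H u| <= B) ->
  (forall u, X < u -> H u = 0) ->
  (forall u : R, is_derive u (1 : R) H (- g u)) ->
  smooth_family line_ok far k.+1 (fun i y => H (radius i y - i.2)).
Proof.
move=> sg [B hB] H0 dH.
split.
- by exists B => i y _; exact: hB.
- by move=> i y [_ /andP[_ i1]]; rewrite /far => Xr; rewrite H0//; lra.
exists (fun i y => - 1 * (y ^+ 1 * (radius i y)^-1 ^+ 1 * g (radius i y - i.2))).
  move=> i y ok; rewrite !expr1 mulN1r.
  have [rd|dr] := ltP (radius i y) d.
    rewrite (bump0 sg (off_of_radius ok rd)) mulr0 oppr0.
    (* H is constant left of d, so the composite is locally constant even at r = 0, where the radius
       has no derivative. *)
    have Hd u v : u < d -> v < d -> H u = H v.
      wlog uv : u v / u <= v.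
        move=> h ud vd; have [uv|/ltW vu] := leP u v; first exact: h.
        by rewrite (h v u).
      move=> ud vd; have cH : {within `[u, v], continuous H}.
        apply: derivable_within_continuous => z _; by case: (dH z).
      have [z] := MVT_segment uv (fun x _ => dH x) cH.
      rewrite in_itv/= => /andP[uz zv].
      rewrite (bump0 sg) ?oppr0 ?mul0r => [|/andP[dz _]]; last first.
        by have := le_lt_trans zv vd; rewrite ltNge dz.
      by move/subr0_eq.
    have := is_derive_cst (H (radius i y - i.2)) y (1 : R).
    apply: near_eq_is_derive.
    apply: filterS (near_radius_lt rd) => z zd /=.
    by case: ok => _ /andP[i0 _]; apply: Hd; lra.
  have r0 : 0 < radius i y by exact: lt_le_trans dr.
  have dr2 := is_derive_add_fun (is_derive_radius ok r0)
    (is_derive_cst (- i.2) y (1 : R)) erefl.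
  apply: (is_derive_comp_fun (dH _) dr2).
  by rewrite addr0 mulNr mulrC.
by apply: smooth_familyZ; exact: profile_smooth.
Qed.

End radial_profiles.

(** * Affine changes of variables *)

Section lebesgue_affine.
Context (R : realType).
Local Notation leb := (@lebesgue_measure R).
Implicit Types (c b : R).

Definition affine c b : measurableTypeR R -> measurableTypeR R :=
  fun x => c * x + b.

Lemma measurable_affine c b : measurable_fun setT (affine c b).
Proof.
apply: measurable_funD => //; exact: measurable_funM.
Qed.

Lemma affine_preimage_itv c b (x y : R) : 0 < c ->
  affine c b @^-1` `]x, y] = `](x - b) / c, (y - b) / c]%classic.
Proof.
move=> c0; apply/seteqP; split => z /=; rewrite !in_itv/=;
  by rewrite ltr_pdivrMr// ler_pdivlMr// ltrBlDr lerBrDr mulrC.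
Qed.

Local Open Scope ereal_scope.

(** Uniqueness of Lebesgue measure: the rescaled image measure agrees with it on half-open
    intervals. *)
Lemma lebesgue_affine c b (A : set (measurableTypeR R)) : (0 < c)%R ->
  measurable A -> c%:E * leb (affine c b @^-1` A) = leb A.
Proof.
move=> c0 mA; pose k := NngNum (ltW c0).
pose p := measure_function_pushforward__canonical__measure_function_Measure
  leb (measurable_affine c b).
suff : leb A = mscale k p A by [].
apply: lebesgue_measure_unique mA => _ [[x y] _ <-].
rewrite -[RHS]/(c%:E * leb (affine c b @^-1` `]x, y])) affine_preimage_itv//.
rewrite !lebesgue_measure_itv/= !lte_fin ltr_pM2r ?invr_gt0// ltrD2r.
case: ifP => _; last by rewrite mule0.
by rewrite -EFinM; congr EFin; field; rewrite gt_eqF.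
Qed.

Lemma ge0_integral_affine c b (F : R -> \bar R) : (0 < c)%R ->
  measurable_fun setT F -> (forall x, 0 <= F x) ->
  c%:E * \int[leb]_x F (c * x + b)%R = \int[leb]_x F x.
Proof.
move=> c0 mF F0; pose k := NngNum (ltW c0).
pose p := measure_function_pushforward__canonical__measure_function_Measure
  leb (measurable_affine c b).
transitivity (\int[mscale k p]_x F x).
  rewrite ge0_integral_mscale//; congr (_ * _).
  rewrite ge0_integral_pushforward//.
  exact: measurable_affine.
by apply: eq_measure_integral => A mA _; exact: lebesgue_affine.
Qed.

Lemma integral_affine c b (F : R -> \bar R) : (0 < c)%R ->
  measurable_fun setT F ->
  c%:E * \int[leb]_x F (c * x + b)%R = \int[leb]_x F x.
Proof.
move=> c0 mF; rewrite integralE [RHS]integralE.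
rewrite -(ge0_integral_affine b c0 (measurable_funepos mF))//.
rewrite -(ge0_integral_affine b c0 (measurable_funeneg mF))//.
pose P := \int[leb]_x F^\+ (c * x + b)%R; pose Q := \int[leb]_x F^\- (c * x + b)%R.
have P0 : 0 <= P by exact: integral_ge0.
have Q0 : 0 <= Q by exact: integral_ge0.
have e1 : \int[leb]_x (fun x => F (c * x + b)%R)^\+ x = P.
  by apply: eq_integral => x _; rewrite !funeposE.
have e2 : \int[leb]_x (fun x => F (c * x + b)%R)^\- x = Q.
  by apply: eq_integral => x _; rewrite !funenegE.
rewrite -/P -/Q e1 e2 {e1 e2}.
(* Either part may be infinite; [+oo - oo] is [-oo] by convention, which a factor c > 0 respects. *)
case: P Q P0 Q0 => [p| |] [q| |]//= _ _.
- by rewrite -!EFinM -!EFinD mulrDr mulrN.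
- by rewrite mulrNy gtr0_sg// mul1e mulry gtr0_sg// mul1e.
- by rewrite mulry gtr0_sg// mul1e.
- by rewrite (_ : +oo + -oo = -oo)// mulrNy mulry gtr0_sg// !mul1e.
Qed.

End lebesgue_affine.

Section tuple_affine.
Context (R : realType).
Local Notation tupleR n := (n.-tuple (measurableTypeR R)).

Definition tuple_affine n (c : R) (v : 'I_n -> R) (s : tupleR n) : tupleR n :=
  [tuple c * tnth s i + v i | i < n].

Lemma measurable_tuple_affine n c (v : 'I_n -> R) :
  measurable_fun setT (tuple_affine c v).
Proof.
apply/measurable_fun_tnthP => i.
rewrite (_ : _ \o _ = fun s => c * tnth s i + v i); last first.
  by apply/funext => s /=; rewrite tnth_mktuple.
apply: measurable_funD => //; apply: measurable_funM => //.
exact: measurable_tnth.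
Qed.

Local Open Scope ereal_scope.

Lemma tuple_lebesgue_affine n (c : R) (v : 'I_n -> R) (A : set (tupleR n)) :
  (0 < c)%R -> measurable A ->
  (c ^+ n)%:E * tuple_lebesgue R n (tuple_affine c v @^-1` A) =
  tuple_lebesgue R n A.
Proof.
move=> c0; elim: n v A => [|n IH] v A mA.
  rewrite expr0 mul1e; congr (tuple_lebesgue R 0 _).
  apply/seteqP; split => s /=; rewrite [tuple_affine _ _ _]tuple0 [s]tuple0//.
pose w i := v (lift ord0 i); pose mu := tuple_lebesgue R n.
have mcons (B : set (tupleR n.+1)) : measurable B ->
    measurable (@cons_pair R n @^-1` B).
  by move=> mB; rewrite -[X in measurable X]setTI; exact: measurable_cons_pair.
have mP := mcons _ mA.
have mP' : measurable (@cons_pair R n @^-1` (tuple_affine c v @^-1` A)).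
  by apply: mcons; rewrite -[X in measurable X]setTI; exact: measurable_tuple_affine.
set P := _ @^-1` A in mP; set P' := _ @^-1` _ in mP'.
(* Sections of the preimage are preimages of sections, so the induction hypothesis handles the tail
   coordinates and the one-dimensional case the head. *)
have PP' x : xsection P' x = tuple_affine c w @^-1` xsection P (c * x + v ord0)%R.
  apply/seteqP; split => s; rewrite /xsection/= !inE /P /P' /=;
    suff -> : tuple_affine c v (cons_pair (x, s)) =
      cons_pair ((c * x + v ord0)%R, tuple_affine c w s) by [];
    apply/eq_from_tnth => i; rewrite tnth_mktuple;
    by have [j ->|->] := unliftP ord0 i; rewrite /cons_pair/= ?tnthS ?tnth_mktuple.
transitivity (c%:E * ((c ^+ n)%:E * \int[lebesgue_measure]_x mu (xsection P' x))).
  by rewrite muleA -EFinM -exprS.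
rewrite -ge0_integralZl//; last 2 first.
- exact: measurable_fun_xsection.
- by rewrite lee_fin exprn_ge0// ltW.
transitivity (c%:E * \int[lebesgue_measure]_x mu (xsection P (c * x + v ord0)%R)).
  congr (_ * _); apply: eq_integral => x _.
  by rewrite PP' /mu IH//; exact: measurable_xsection.
rewrite (@ge0_integral_affine R c (v ord0) (fun x => mu (xsection P x)))//.
exact: measurable_fun_xsection.
Qed.

End tuple_affine.

(** * The quadratic form and its lattice points *)

Section quadratic_form.
Context (R : realType) (n : nat) (M : 'M[int]_n).
Implicit Types (x y : 'cV[R]_n) (s : R).

Definition bilform x y : R := inner (map_mx intr M *m x) y.

Lemma innerE x y : inner x y = (x^T *m y) 0 0.
Proof. by rewrite mxE; apply: eq_bigr => i _; rewrite mxE. Qed.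

Lemma bilformE x y : bilform x y = (x^T *m map_mx intr M^T *m y) 0 0.
Proof. by rewrite /bilform innerE trmx_mul map_trmx. Qed.

Lemma bilformDl x1 x2 y : bilform (x1 + x2) y = bilform x1 y + bilform x2 y.
Proof. by rewrite !bilformE linearD !mulmxDl mxE. Qed.

Lemma bilformDr x y1 y2 : bilform x (y1 + y2) = bilform x y1 + bilform x y2.
Proof. by rewrite !bilformE mulmxDr mxE. Qed.

Lemma bilformZl s x y : bilform (s *: x) y = s * bilform x y.
Proof. by rewrite !bilformE linearZ -!scalemxAl mxE. Qed.

Lemma bilformZr s x y : bilform x (s *: y) = s * bilform x y.
Proof. by rewrite !bilformE -scalemxAr mxE. Qed.

Hypothesis hM : posdef_sym R M.

Lemma bilformC x y : bilform x y = bilform y x.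
Proof.
rewrite !bilformE; have -> : (x^T *m map_mx intr M^T *m y) =
    (y^T *m map_mx intr M^T *m x)^T.
  by rewrite hM.1 !trmx_mul trmxK map_trmx hM.1 mulmxA.
by rewrite mxE.
Qed.

Lemma quadformDZ x y s :
  quadform M (x + s *: y) =
  quadform M x + 2 * s * bilform x y + s ^+ 2 * quadform M y.
Proof.
rewrite -[LHS]/(bilform _ _) -[quadform M x]/(bilform x x).
rewrite -[quadform M y]/(bilform y y).
rewrite bilformDl !bilformDr !bilformZl !bilformZr (bilformC y x); ring.
Qed.

Lemma quadformZ x s : quadform M (s *: x) = s ^+ 2 * quadform M x.
Proof.
by rewrite -[LHS]/(bilform _ _) bilformZl bilformZr mulrA -expr2.
Qed.

Lemma quadform_ge0 x : 0 <= quadform M x.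
Proof.
have [->|/hM.2/ltW//] := eqVneq x 0.
by rewrite -(scale0r (0 : 'cV[R]_n)) quadformZ expr0n mul0r.
Qed.

Lemma bilform_CauchySchwarz x y :
  bilform x y ^+ 2 <= quadform M x * quadform M y.
Proof.
have [->|/hM.2 y0] := eqVneq y 0.
  by rewrite -[X in bilform _ X](scale0r 0) bilformZr mul0r expr0n
    mulr_ge0 ?quadform_ge0.
(* The component of x orthogonal to y has nonnegative square length. *)
have := quadform_ge0 (x + (- bilform x y / quadform M y) *: y).
rewrite quadformDZ -(ler_pM2r y0) mul0r => h; rewrite -subr_ge0.
apply: le_trans h _; rewrite le_eqVlt; apply/orP; left; apply/eqP; field.
by rewrite gt_eqF.
Qed.

Lemma posdef_unitmx : map_mx intr M \in @unitmx R n.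
Proof.
rewrite unitmxE unitfE; apply/det0P => -[v v0 vM].
have vT0 : v^T != 0 by rewrite trmx_eq0.
have := hM.2 _ vT0; rewrite -[quadform M _]/(bilform _ _) bilformE trmxK.
by rewrite hM.1 vM mul0mx mxE ltxx.
Qed.

(** The i-th coordinate of x is the pairing of x with M^(-1) e_i, so Cauchy-Schwarz bounds it; the 1
    in the witness only makes the constant positive. *)
Lemma quadform_coercive :
  exists2 K : R, 0 < K & forall x i, x i 0 ^+ 2 <= K * quadform M x.
Proof.
pose u i : 'cV[R]_n := invmx (map_mx intr M) *m delta_mx i 0.
have bu i x : bilform (u i) x = x i 0.
  rewrite /bilform /u mulKVmx ?posdef_unitmx// /inner (bigD1 i)//= mxE !eqxx.
  rewrite mul1r big1 ?addr0// => j ji.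
  by rewrite mxE (negbTE ji) mul0r.
exists (1 + \sum_i quadform M (u i)) => [|x i].
  by rewrite ltr_wpDr// sumr_ge0// => i _; exact: quadform_ge0.
rewrite -{1}bu; apply: le_trans (bilform_CauchySchwarz _ _) _.
apply: ler_wpM2r; first exact: quadform_ge0.
rewrite (bigD1 i)//= addrCA lerDl addr_ge0// sumr_ge0// => j _.
exact: quadform_ge0.
Qed.

End quadratic_form.

(** * Finite boxes of lattice points *)

Section boxes.
Context (n : nat).
Implicit Types (m : 'cV[int]_n) (L : nat).

Definition box_vector L (u : {ffun 'I_n -> 'I_(2 * L).+1}) : 'cV[int]_n :=
  \col_i ((u i : nat)%:Z - L%:Z).

Definition box L : {fset 'cV[int]_n} :=
  [fset box_vector u | u in {: {ffun 'I_n -> 'I_(2 * L).+1}}]%fset.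

Lemma in_boxP L m : reflect (forall i, `|m i 0| <= L%:Z) (m \in box L).
Proof.
rewrite /box; apply: (iffP (imfsetP _ _ _ _)) => [[u _ ->] i|mL].
  by rewrite mxE ler_norml; move: (nat_of_ord _) (ltn_ord (u i)) => k; lia.
have h i : (`|(m i 0 + L%:Z)%R|%N < (2 * L).+1)%N by have := mL i; lia.
exists [ffun i => Ordinal (h i)] => //.
apply/colP => i; rewrite mxE ffunE /=; have := mL i; lia.
Qed.

Lemma card_box_le L : (#|` box L| <= (2 * L).+1 ^ n)%N.
Proof.
apply: leq_trans (leq_imfset_card _ _ _) _.
by rewrite -cardE card_ffun !card_ord.
Qed.

(** Both the box of radius L + 1 and its translate by a unit vector contain the box of radius L,
    hence the support of f. *)
Lemma sum_box_shift (R : realType) L (f : 'cV[int]_n -> R) j :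
  (forall m, f m != 0 -> m \in box L) ->
  \sum_(m <- box L.+1) f m = \sum_(m <- box L.+1) f (m + delta_mx j 0).
Proof.
move=> fL.
have sub1 : (box L `<=` box L.+1)%fset.
  by apply/fsubsetP => m /in_boxP mL; apply/in_boxP => i; have := mL i; lia.
pose sh (m : 'cV[int]_n) := m + delta_mx j 0.
pose B := [fset sh m | m in box L.+1]%fset.
have sub2 : (box L `<=` B)%fset.
  apply/fsubsetP => m /in_boxP mL; apply/imfsetP.
  exists (m - delta_mx j 0); last by rewrite /sh subrK.
  apply/in_boxP => i; have := mL i; rewrite !mxE; case: (_ && _) => /=; lia.
have eqB : \sum_(m <- box L.+1) f (sh m) = \sum_(m <- B) f m.
  rewrite [RHS]big_imfset//= => x y _ _; exact: addIr.
have f0 m : m \notin box L -> f m = 0.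
  by move=> mL; apply/eqP; apply: contraNT mL; exact: fL.
rewrite [RHS]eqB -(big_fset_incl _ sub1) => [|m _ /f0//].
by rewrite -(big_fset_incl _ sub2) => [|m _ /f0//].
Qed.

End boxes.

(** The set S also witnesses finiteness, so [fset_set] does not fall back on its default value. *)
Lemma lattice_countE (R : realType) n (M : 'M[int]_n) (alpha : 'cV[R]_n) (t : R)
    (S : {fset 'cV[int]_n}) :
  (forall m : 'cV[int]_n, quadform M (map_mx intr m - alpha) <= t ^+ 2 -> m \in S) ->
  (lattice_count M alpha t)%:R =
  \sum_(m <- S) (quadform M (map_mx intr m - alpha) <= t ^+ 2)%R%:R :> R.
Proof.
move=> hS; rewrite /lattice_count; set A := [set m | _].
pose p (m : 'cV[int]_n) := quadform M (map_mx intr m - alpha) <= t ^+ 2.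
have -> : A = [set` [fset m in S | p m]%fset].
  apply/seteqP; split => m /=; rewrite !inE /=.
    by move=> hm; apply/andP; split => //; exact: hS.
  by case/andP.
rewrite set_fsetK -sum1_size natr_sum big_fset/= big_mkcond/=.
by apply: eq_bigr => m _; rewrite -/(p m); case: (p m).
Qed.

(** * Volume of the ellipsoid as a mean over shifts *)

Section lattice_volume.
Context (R : realType) (n : nat) (M : 'M[int]_n) (alpha : 'cV[R]_n).
Hypothesis hM : posdef_sym R M.
Local Notation tupleR := (n.-tuple (measurableTypeR R)).
Implicit Types (s g : tupleR) (t : R) (m : 'cV[int]_n) (S : {fset 'cV[int]_n}).

Definition vec s : 'cV[R]_n := \col_i tnth s i.

Definition lattice_point m g : 'cV[R]_n := map_mx intr m - alpha + vec g.

Definition count_in S g t : R :=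
  \sum_(m <- S) (quadform M (lattice_point m g) <= t ^+ 2)%R%:R.

(** Half-open, so that its integer translates tile the space without overlap. *)
Definition unit_cube : set tupleR :=
  [set s | forall i, `[0%R, 1%R[%classic (tnth s i)].

Lemma measurable_quadform (v : 'cV[R]_n) :
  measurable_fun setT (fun s => quadform M (v + vec s)).
Proof.
have mcoord i : measurable_fun setT (fun s => (v + vec s) i 0).
  rewrite (_ : (fun s => _) = fun s => v i 0 + tnth s i); last first.
    by apply/funext => s; rewrite !mxE.
  by apply: measurable_funD => //; exact: measurable_tnth.
apply: measurable_sum => i; apply: measurable_funM => //.
rewrite (_ : (fun s => _) =
    fun s => \sum_j map_mx intr M i j * (v + vec s) j 0); last first.
  by apply/funext => s; rewrite mxE.
by apply: measurable_sum => j; apply: measurable_funM.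
Qed.

Lemma measurable_sublevel (v : 'cV[R]_n) t :
  measurable [set s | quadform M (v + vec s) <= t].
Proof.
rewrite -[X in measurable X]setTI.
by apply: measurable_fun_le => //; exact: measurable_quadform.
Qed.

Lemma measurable_box (a b : 'I_n -> R) :
  measurable ([set s | forall i, `[a i, b i[%classic (tnth s i)] : set tupleR).
Proof.
rewrite (_ : [set s | _] = \bigcap_(i in [set: 'I_n])
    ((fun s : tupleR => tnth s i) @^-1` `[a i, b i[%classic)); last first.
  by apply/seteqP; split => s /= h i => [_|]; exact: h.
apply: fin_bigcap_measurable; first exact: finite_finset.
by move=> i _; rewrite -[X in measurable X]setTI; exact: measurable_tnth.
Qed.

Lemma measurable_unit_cube : measurable unit_cube.
Proof. exact: measurable_box. Qed.

Lemma unit_cube_measure : tuple_lebesgue R n unit_cube = 1%E.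
Proof.
rewrite (@tuple_lebesgue_box R n (fun=> `[0%R, 1%R[%classic))// big1// => i _.
by rewrite lebesgue_measure_itv/= lte_fin ltr01 oppr0 adde0.
Qed.

Definition sublevel t : set tupleR := [set s | quadform M (vec s) <= t ^+ 2].

Lemma measurable_sublevel0 t : measurable (sublevel t).
Proof.
have := measurable_sublevel 0 (t ^+ 2).
by under eq_set do rewrite add0r.
Qed.

Lemma sublevel_finite t : (tuple_lebesgue R n (sublevel t) < +oo)%E.
Proof.
have [K K0 hK] := quadform_coercive hM.
(* The added 1 fits the closed coordinate range into half-open intervals. *)
pose r := Num.sqrt (K * t ^+ 2) + 1.
have r0 : 0 < r by rewrite ltr_wpDl// sqrtr_ge0.
apply: (@le_lt_trans _ _ (tuple_lebesgue R n
  [set s | forall i, `[- r, r[%classic (tnth s i)])).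
  apply: le_measure; rewrite ?inE.
  - exact: measurable_sublevel0.
  - exact: (measurable_box (fun=> - r) (fun=> r)).
  move=> s hs i /=; rewrite in_itv/=.
  have h : `|tnth s i| <= Num.sqrt (K * t ^+ 2).
    rewrite -sqrtr_sqr ler_sqrt; last by rewrite mulr_ge0 ?sqr_ge0// ltW.
    have := hK (vec s) i; rewrite mxE => /le_trans; apply.
    by rewrite ler_wpM2l// ltW.
  by move: h; rewrite ler_norml /r => /andP[h1 h2]; apply/andP; split; lra.
rewrite (@tuple_lebesgue_box R n (fun=> `[- r, r[%classic))//.
rewrite (_ : (\prod_(i < n) _)%E = ((\prod_(i < n) (r + r))%:E)) ?ltry//.
rewrite -prodEFin; apply: eq_bigr => i _.
by rewrite lebesgue_measure_itv/= lte_fin gtrN// opprK EFinD.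
Qed.

Lemma volume_sublevel1 :
  (volume (ellipsoid M))%:E = tuple_lebesgue R n (sublevel 1).
Proof.
rewrite /volume (_ : [set s | _] = sublevel 1); last first.
  by apply/seteqP; split => s; rewrite /sublevel /ellipsoid/= expr1n.
(* Finiteness matters: [fine] would turn an infinite volume into 0. *)
by rewrite fineK// ge0_fin_numE// sublevel_finite.
Qed.

Lemma volume_sublevel t : 0 < t ->
  tuple_lebesgue R n (sublevel t) = (volume (ellipsoid M) * t ^+ n)%:E.
Proof.
move=> t0; have ti0 : 0 < t^-1 by rewrite invr_gt0.
rewrite EFinM volume_sublevel1.
rewrite -(tuple_lebesgue_affine (fun=> 0) ti0 (measurable_sublevel0 1)).
rewrite (_ : tuple_affine _ _ @^-1` _ = sublevel t); last first.
  have E s : vec (tuple_affine t^-1 (fun=> 0) s) = t^-1 *: vec s.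
    by apply/colP => i; rewrite !mxE tnth_mktuple addr0.
  apply/seteqP; split => s; rewrite /sublevel/= E quadformZ expr1n exprVn;
    by rewrite mulrC ler_pdivrMr ?exprn_gt0// mul1r.
rewrite muleC muleA -EFinM -exprMn mulfV ?gt_eqF// expr1n mul1e//.
Qed.

(** Unfolding: translated by m - alpha, the pieces become the intersections of the dilated ellipsoid
    with disjoint tiles, and S contains every m whose tile meets it. *)
Lemma cube_sum S t :
  (forall m s, unit_cube s -> quadform M (lattice_point m s) <= t ^+ 2 -> m \in S) ->
  (\sum_(m <- S) tuple_lebesgue R n
     ([set s | (quadform M (lattice_point m s) <= t ^+ 2)%R] `&` unit_cube) =
   tuple_lebesgue R n (sublevel t))%E.
Proof.
move=> hS.
pose v m i : R := (map_mx intr m - alpha) i 0.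
pose C m := sublevel t `&`
  [set s | forall i, `[v m i, v m i + 1[%classic (tnth s i)].
have mC m : measurable (C m).
  apply: measurableI; first exact: measurable_sublevel0.
  exact: (measurable_box (v m) (fun i => v m i + 1)).
transitivity (\sum_(m <- S) tuple_lebesgue R n (C m))%E.
  apply: eq_bigr => m _.
  rewrite -(tuple_lebesgue_affine (v m) ltr01 (mC m)) expr1n mul1e.
  congr (tuple_lebesgue R n _).
  have E s : vec (tuple_affine 1 (v m) s) = lattice_point m s.
    by apply/colP => i; rewrite !mxE tnth_mktuple mul1r addrC /v !mxE.
  apply/seteqP; split => s; rewrite /C /sublevel/= E => -[h1 h2]; split => // i;
    have := h2 i; rewrite tnth_mktuple /= !in_itv/= mul1r => /andP[? ?];
    by apply/andP; split; lra.
rewrite -measure_fbigsetU//; last first.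
  apply/trivIsetP => m1 m2 _ _ m12; apply/seteqP; split => // s [[_ h1] [_ h2]].
  move/eqP: m12; apply; apply/colP => i; have := h1 i; have := h2 i.
  rewrite /= !in_itv/= /v !mxE => /andP[a1 a2] /andP[b1 b2].
  (* The tile of a point is recovered from the floors of its coordinates shifted by alpha. *)
  rewrite -[LHS](@floor_def R (tnth s i + alpha i 0)).
    by apply: floor_def; rewrite intrD; apply/andP; split; lra.
  by rewrite intrD; apply/andP; split; lra.
congr (tuple_lebesgue R n _); rewrite -bigcup_fset.
apply/seteqP; split => s; first by case=> m _ [].
move=> hs; pose m : 'cV[int]_n := \col_i Num.floor (tnth s i + alpha i 0).
have sC : C m s.
  split => // i; rewrite /= in_itv/= /v !mxE.
  have := @floor_itv R (tnth s i + alpha i 0); rewrite intrD => /andP[? ?].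
  by apply/andP; split; lra.
exists m => //=.
pose g : tupleR := tuple_affine 1 (fun i => - v m i) s.
have E : lattice_point m g = vec s.
  by apply/colP => i; rewrite !mxE tnth_mktuple mul1r /v !mxE; ring.
apply: (hS m g); last by rewrite E.
move=> i; case: sC => _ /(_ i); rewrite /= !in_itv/= tnth_mktuple mul1r.
by move=> /andP[? ?]; apply/andP; split; lra.
Qed.

Lemma cube_average_count S t : 0 < t ->
  (forall m s, unit_cube s -> quadform M (lattice_point m s) <= t ^+ 2 -> m \in S) ->
  (\int[tuple_lebesgue R n]_(s in unit_cube) (count_in S s t)%:E =
   (volume (ellipsoid M) * t ^+ n)%:E)%E.
Proof.
move=> t0 hS; rewrite -volume_sublevel// -(cube_sum hS).
have mA m : measurable [set s | quadform M (lattice_point m s) <= t ^+ 2].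
  exact: measurable_sublevel.
have E m s : ((quadform M (lattice_point m s) <= t ^+ 2)%R%:R : R) =
    \1_[set s | quadform M (lattice_point m s) <= t ^+ 2] s.
  rewrite indicE.
  have [h|/negP h] := boolP (quadform M (lattice_point m s) <= t ^+ 2).
    by rewrite mem_set.
  by rewrite memNset.
under eq_integral do rewrite -sumEFin.
rewrite ge0_integral_sum//; last 2 first.
- exact: measurable_unit_cube.
- move=> m; under eq_fun do rewrite E.
  by apply/measurable_EFinP; exact: measurable_indic.
apply: eq_bigr => m _; under eq_integral do rewrite E.
by rewrite integral_indic//; exact: measurable_unit_cube.
Qed.

End lattice_volume.

(** * Primitives of bumps *)

Section bump_tail.
Context (R : realType) (d X : R).
Local Notation leb := (@lebesgue_measure R).
Implicit Types (f h : R -> R).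

Lemma compact_support_integrable f (B : R) : measurable_fun setT f ->
  (forall u, `|f u| <= B) -> (forall u, ~ (d <= u <= X) -> f u = 0) ->
  leb.-integrable setT (EFin \o f).
Proof.
move=> mf fB f0.
have B0 : 0 <= B by exact: le_trans (fB 0).
have mI : measurable (`[d, X]%classic : set (measurableTypeR R)) by [].
have iI : leb.-integrable setT (EFin \o (\1_`[d, X] : R -> R)).
  exact: (integrable_indic_itv d X true false).
apply: (le_integrable measurableT _ _ (integrableZl measurableT B iI)).
  exact/measurable_EFinP.
move=> u _ /=; rewrite lee_fin indicE.
have [/andP[du uX]|/f0 ->] := pselect (d <= u <= X); last by rewrite normr0.
by rewrite mem_set/= ?in_itv/= ?du// mulr1 (le_trans (fB u))// ler_norm.
Qed.

Variable h : R -> R.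
Hypothesis sh : bump d X 1 h.

Lemma bump_derivable u : derivable h u 1.
Proof. by have [h' dh _] := bump_deriv sh; case: (dh u). Qed.

Lemma bump_continuous : continuous h.
Proof.
by move=> u; apply/differentiable_continuous/derivable1_diffP/bump_derivable.
Qed.

Lemma bump_measurable : measurable_fun setT h.
Proof. by apply: continuous_measurable_fun; exact: bump_continuous. Qed.

Lemma bump_integrable : leb.-integrable setT (EFin \o h).
Proof.
have [B _ hB] := bump_bounded sh.
apply: compact_support_integrable bump_measurable hB _ => u.
exact: bump0 sh.
Qed.

Definition tail (v : R) : R := \int[leb]_(u in `]v, +oo[) h u.

Lemma tailE v : tail v = \int[leb]_u h u - \int[leb]_(u in `]-oo, v]) h u.
Proof.
have := @Rintegral_itvB R h -oo%O +oo%O v; rewrite set_itvE /tail => <- //.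
exact: bump_integrable.
Qed.

Lemma is_derive_tail (v : R) : is_derive v (1 : R) tail (- h v).
Proof.
have vv : v < v + 1 by rewrite ltrDl.
have ih : leb.-integrable [set` Interval -oo%O (BRight (v + 1))] (EFin \o h).
  exact: integrableS bump_integrable.
have [dF F'] := continuous_FTC1 vv ih (ltNyr _) (@bump_continuous v).
have -> : tail = fun v => \int[leb]_u h u + - \int[leb]_(u in `]-oo, v]) h u.
  by apply/funext => z; exact: tailE.
have dc := is_derive_cst (\int[leb]_u h u) v (1 : R).
have dF' : is_derive v (1 : R) (fun v => \int[leb]_(u in `]-oo, v]) h u) (h v).
  by apply: DeriveDef => //; rewrite -derive1E.
apply: (is_derive_add_fun dc (is_deriveN dF')).
by rewrite add0r.
Qed.

Lemma tail_gt v : X < v -> tail v = 0.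
Proof.
move=> Xv; rewrite /tail (@eq_Rintegral _ _ _ leb _ (cst 0)); last first.
  move=> u; rewrite inE/= in_itv/= andbT => vu; apply: (bump0 sh) => /andP[_].
  by rewrite leNgt (lt_trans Xv vu).
by rewrite Rintegral_cst// mul0r.
Qed.

Lemma tail_bounded : exists B : R, forall v, `|tail v| <= B.
Proof.
exists (\int[leb]_u `|h u|) => v.
rewrite /tail; apply: le_trans (le_normr_Rintegral _ _) _ => //.
  exact: integrableS bump_integrable.
have ih := integrable_norm bump_integrable.
rewrite [leLHS]Rintegral_mkcond; apply: le_Rintegral => //.
  rewrite -restrict_EFin; apply: (integrable_mkcond _ _).1 => //.
  exact: integrableS ih.
by move=> u _; rewrite patchE; case: ifP => // _; exact: normr_ge0.
Qed.

Lemma tail_smooth k : bump d X k h -> 0 < d ->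
  smooth_family (@line_ok R) (far X) k.+1 (fun i y => tail (radius i y - i.2)).
Proof.
move=> shk d0.
exact: (primitive_profile_smooth d0 shk tail_bounded tail_gt is_derive_tail).
Qed.

(** A lattice point at scaled distance v is counted at radius u exactly when v <= u, so its total
    weight is [tail h v]; the endpoint has measure 0. *)
Lemma integral_ge_tail v :
  (\int[leb]_u ((v <= u)%R%:R * h u)%:E = (tail v)%:E)%E.
Proof.
have iv : leb.-integrable `]v, +oo[ (EFin \o h).
  exact: integrableS bump_integrable.
rewrite /tail Rintegral_itv_obnd_cbnd// /Rintegral fineK; last first.
  by apply: integrable_fin_num => //; exact: integrableS bump_integrable.
rewrite [RHS]integral_mkcond; apply: eq_integral => u _; rewrite patchE.
by rewrite mem_setE in_itv/= andbT; case: ifP; rewrite ?mul1r ?mul0r.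
Qed.

End bump_tail.

(** * Dependence of smoothed sums on the shift *)

Section oscillation.
Context (R : realType) (n : nat) (M : 'M[int]_n) (alpha : 'cV[R]_n).
Hypothesis hM : posdef_sym R M.
Implicit Types (x : 'cV[R]_n) (s t T th : R) (m : 'cV[int]_n) (L : nat).
Local Notation E j := (delta_mx j 0 : 'cV[R]_n).

Definition axis_norm (j : 'I_n) : R := Num.sqrt (quadform M (E j)).

(* x / T on its line parallel to the j-th axis, in the Euclidean structure whose
   norm is |x|_M: line_coord is its position, line_index the pair (c, th). *)
Definition line_coord T j x := bilform M x (E j) / (axis_norm j * T).

Definition line_index T th j x : R * R :=
  ((quadform M x - bilform M x (E j) ^+ 2 / quadform M (E j)) / T ^+ 2, th).

Lemma quadform_axis_gt0 j : 0 < quadform M (E j).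
Proof.
apply: hM.2; apply/eqP => /colP/(_ j); rewrite !mxE !eqxx => /eqP.
by rewrite oner_eq0.
Qed.

Lemma axis_norm_gt0 j : 0 < axis_norm j.
Proof. by rewrite sqrtr_gt0 quadform_axis_gt0. Qed.

Lemma sqr_axis_norm j : axis_norm j ^+ 2 = quadform M (E j).
Proof. by rewrite sqr_sqrtr// ltW// quadform_axis_gt0. Qed.

Lemma line_index_ok T th j x : 0 < T -> 0 <= th <= 1 ->
  line_ok (line_index T th j x).
Proof.
move=> T0 th01; split => //=; rewrite divr_ge0 ?sqr_ge0// subr_ge0.
rewrite ler_pdivrMr ?quadform_axis_gt0//; exact: bilform_CauchySchwarz.
Qed.

(** Pythagoras for the inner product defined by M. *)
Lemma radius_line T th j x : 0 < T ->
  radius (line_index T th j x) (line_coord T j x) = Num.sqrt (quadform M x) / T.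
Proof.
move=> T0; have a0 := axis_norm_gt0 j.
have -> : Num.sqrt (quadform M x) / T = Num.sqrt (quadform M x / T ^+ 2).
  by rewrite sqrtrM ?quadform_ge0// sqrtrV ?sqr_ge0// sqrtr_sqr gtr0_norm.
rewrite /radius /line_coord /= -sqr_axis_norm; congr Num.sqrt.
by field; rewrite !gt_eqF.
Qed.

Lemma line_index_shift T th j x s :
  line_index T th j (x + s *: E j) = line_index T th j x.
Proof.
rewrite /line_index quadformDZ// bilformDl bilformZl.
rewrite -[bilform M (E j) (E j)]/(quadform M (E j)).
by congr pair; congr (_ / _); field; rewrite gt_eqF ?quadform_axis_gt0.
Qed.

Lemma line_coord_shift T j x s : 0 < T ->
  line_coord T j (x + s *: E j) = line_coord T j x + axis_norm j / T * s.
Proof.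
move=> T0; have a0 := axis_norm_gt0 j.
rewrite /line_coord bilformDl bilformZl -[bilform M (E j) (E j)]/(quadform M (E j)).
by rewrite -sqr_axis_norm; field; rewrite !gt_eqF.
Qed.

Context (X : R) (H : R -> R).

Definition smoothed_sum T th L x : R :=
  \sum_(m <- box n L.+1)
    H (Num.sqrt (quadform M (map_mx intr m - alpha + x)) / T - th).

(** Adding e_j to m keeps the line and advances the position by [axis_norm j / T]. The box exceeds
    the support by one layer, so sums over it are invariant under this step, as
    [periodic_sum_oscillation] requires. *)
Lemma smoothed_sum_line k :
  smooth_family (@line_ok R) (far X) k.+1 (fun i y => H (radius i y - i.2)) ->
  exists2 B : R, 0 <= B &
  forall T th L x j s t, 0 < T -> 0 <= th <= 1 ->
    (forall m, quadform M (map_mx intr m - alpha + x) <= ((X + 1) * T) ^+ 2 ->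
       m \in box n L) ->
    0 <= s <= 1 -> 0 <= t <= 1 ->
    `|smoothed_sum T th L (x + s *: E j) - smoothed_sum T th L (x + t *: E j)|
      <= (#|` box n L.+1|)%:R * B * (axis_norm j / T) ^+ k.+1.
Proof.
move=> sH; have [B B0 hB] := periodic_sum_oscillation sH.
exists B => // T th L x j s t T0 th01 hL s01 t01.
pose p m : 'cV[R]_n := map_mx intr m - alpha + x.
have r0 : 0 < axis_norm j / T by rewrite divr_gt0// axis_norm_gt0.
have ok m : line_ok (line_index T th j (p m)) by exact: line_index_ok.
have per (G : R * R -> R -> R) :
    (forall i y, line_ok i -> far X i y -> G i y = 0) ->
    \sum_(m <- box n L.+1) G (line_index T th j (p m)) (line_coord T j (p m)) =
    \sum_(m <- box n L.+1) G (line_index T th j (p m))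
      (line_coord T j (p m) + axis_norm j / T).
  move=> G0.
  rewrite (sum_box_shift (f := fun m =>
    G (line_index T th j (p m)) (line_coord T j (p m))) j).
    apply: eq_bigr => m _.
    have -> : p (m + delta_mx j 0) = p m + 1 *: E j.
      by apply/colP => i; rewrite !mxE intrD mul1r; case: (_ && _); rewrite /=; ring.
    by rewrite line_index_shift line_coord_shift// mulr1.
  move=> m; apply: contraR => mL; apply/eqP; apply: G0 => //.
  rewrite /far radius_line// ltNge; apply: contra mL => hfar; apply: hL.
  rewrite -/(p m) -[quadform _ _]sqr_sqrtr ?quadform_ge0//.
  move: hfar; rewrite ler_pdivrMr// => hfar.
  rewrite lerXn2r// ?nnegrE ?sqrtr_ge0//.
  exact: le_trans (sqrtr_ge0 _) hfar.
have := hB _ (box n L.+1) _ _ _ r0 ok per s t s01 t01.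
suff S u : \sum_(m <- box n L.+1) H (radius (line_index T th j (p m))
     (line_coord T j (p m) + axis_norm j / T * u) - th) =
     smoothed_sum T th L (x + u *: E j) by rewrite !S.
apply: eq_bigr => m _; rewrite -line_coord_shift// -(line_index_shift _ _ _ _ u).
by rewrite radius_line// /p addrA.
Qed.

(** The point x is reached from 0 by n steps parallel to the axes: [y l] keeps the first l
    coordinates of x. The path stays in the unit cube, so the bound along lines applies to each
    step. *)
Lemma smoothed_sum_cube k :
  smooth_family (@line_ok R) (far X) k.+1 (fun i y => H (radius i y - i.2)) ->
  exists2 B : R, 0 <= B &
  forall T th L x, 0 < T -> 0 <= th <= 1 ->
    (forall m x, (forall i, 0 <= x i 0 <= 1) ->
       quadform M (map_mx intr m - alpha + x) <= ((X + 1) * T) ^+ 2 ->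
       m \in box n L) ->
    (forall i, 0 <= x i 0 <= 1) ->
    `|smoothed_sum T th L x - smoothed_sum T th L 0|
      <= (#|` box n L.+1|)%:R * B * T^-1 ^+ k.+1.
Proof.
move=> sH; have [B B0 hB] := smoothed_sum_line sH.
pose A := \sum_j axis_norm j.
have A0 : 0 <= A by apply: sumr_ge0 => j _; exact/ltW/axis_norm_gt0.
exists (n%:R * B * A ^+ k.+1); first by rewrite !mulr_ge0// exprn_ge0.
move=> T th L x T0 th01 hL x01.
pose eps := (#|` box n L.+1|)%:R * B * (A / T) ^+ k.+1.
have eps0 : 0 <= eps by rewrite !mulr_ge0// exprn_ge0// divr_ge0// ltW.
pose y l : 'cV[R]_n := \col_i (if (i < l)%N then x i 0 else 0).
have y01 l i : 0 <= y l i 0 <= 1.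
  by rewrite mxE; case: ifP => // _; rewrite lexx ler01.
suff key l : (l <= n)%N ->
    `|smoothed_sum T th L (y l) - smoothed_sum T th L 0| <= l%:R * eps.
  have -> : x = y n by apply/colP => i; rewrite mxE ltn_ord.
  apply: le_trans (key _ (leqnn n)) _.
  by rewrite /eps exprMn le_eqVlt; apply/orP; left; apply/eqP; ring.
elim: l => [_|l IH ln].
  rewrite (_ : y 0 = 0) ?subrr ?normr0 ?mul0r//.
  by apply/colP => i; rewrite !mxE ltn0.
have yS : y l.+1 = y l + x (Ordinal ln) 0 *: E (Ordinal ln).
  apply/colP => i; rewrite !mxE ltnS leq_eqVlt eqxx andbT -(inj_eq val_inj)/=.
  have [il|_|il] := ltngtP; rewrite /= ?mulr0 ?addr0 ?mulr1 ?add0r//.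
  by congr (x _ _); apply/val_inj.
rewrite -(subrKA (smoothed_sum T th L (y l))) -natr1 mulrDl mul1r addrC.
apply: le_trans (ler_normD _ _) _; apply: lerD; first exact/IH/ltnW.
have := hB T th L (y l) (Ordinal ln) (x (Ordinal ln) 0) 0 T0 th01.
rewrite scale0r addr0 yS => /(_ _ (x01 _)) h.
apply: le_trans (h _ _) _; first by move=> m; exact: hL.
  by rewrite lexx ler01.
rewrite /eps ler_wpM2l ?mulr_ge0// lerXn2r ?nnegrE ?divr_ge0 ?(ltW T0)//.
  exact/ltW/axis_norm_gt0.
rewrite ler_wpM2r ?invr_ge0 ?(ltW T0)// /A (bigD1 (Ordinal ln))//= lerDl.
by apply: sumr_ge0 => j _; exact/ltW/axis_norm_gt0.
Qed.

End oscillation.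

(** * The smoothed discrepancy *)

Lemma measurable_le_indicator (R : realType) (disp : measure_display)
    (T : measurableType disp) (f h : T -> R) :
  measurable_fun setT f -> measurable_fun setT h ->
  measurable_fun setT (fun x => (f x <= h x)%R%:R : R).
Proof.
move=> mf mh; rewrite (_ : (fun x => _) = \1_[set x | f x <= h x]).
  apply: measurable_indic; rewrite -[X in measurable X]setTI.
  exact: measurable_fun_le.
apply/funext => x; rewrite indicE; have [fh|/negP fh] := boolP (f x <= h x).
  by rewrite mem_set.
by rewrite memNset.
Qed.

Section discrepancy.
Context (R : realType) (n : nat) (M : 'M[int]_n) (alpha : 'cV[R]_n).
Hypothesis hM : posdef_sym R M.
Local Notation leb := (@lebesgue_measure R).
Local Notation tupleR := (n.-tuple (measurableTypeR R)).

Lemma lattice_box (X : R) :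
  exists2 C : R, 0 <= C &
  forall T : R, 1 <= T -> exists2 L : nat,
    (forall (m : 'cV[int]_n) (x : 'cV[R]_n), (forall i, 0 <= x i 0 <= 1) ->
       quadform M (map_mx intr m - alpha + x) <= ((X + 1) * T) ^+ 2 ->
       m \in box n L) &
    (#|` box n L.+1|)%:R <= (C * T) ^+ n.
Proof.
have [K K0 hK] := quadform_coercive hM.
pose A := \sum_i `|alpha i 0|.
have A0 : 0 <= A by exact: sumr_ge0.
have hA i : `|alpha i 0| <= A.
  by rewrite /A (bigD1 i)//= lerDl sumr_ge0.
(* The three terms bound the coordinates of m - alpha + x, alpha and x, in units of T >= 1. *)
pose Y := Num.sqrt K * `|X + 1| + A + 1.
have Y0 : 0 <= Y by rewrite !addr_ge0// mulr_ge0// sqrtr_ge0.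
(* With L <= Y T, the side count 2 (L + 1) + 1 is at most 2 Y T + 3 <= (2 Y + 3) T. *)
exists (2 * Y + 3); first by lra.
move=> T T1; have T0 : 0 <= T by lra.
have YT0 : 0 <= Y * T by exact: mulr_ge0.
exists (Num.truncn (Y * T)) => [m x x01 hQ|].
  apply/in_boxP => i.
  suff h : `|(m i 0)%:~R : R| <= Y * T.
    by rewrite -abszE lez_nat truncn_ge_nat// natr_absz intr_norm.
  pose z := map_mx intr m - alpha + x.
  have zE : (m i 0)%:~R = z i 0 + (alpha i 0 - x i 0) :> R by rewrite !mxE; ring.
  have hz : `|z i 0| <= Num.sqrt K * `|X + 1| * T.
    have -> : Num.sqrt K * `|X + 1| * T = Num.sqrt (K * ((X + 1) * T) ^+ 2).
      by rewrite sqrtrM ?(ltW K0)// sqrtr_sqr normrM (ger0_norm T0) mulrA.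
    rewrite -sqrtr_sqr ler_sqrt; last by apply: mulr_ge0 (ltW K0) (sqr_ge0 _).
    by apply: le_trans (hK z i) _; rewrite ler_wpM2l// ltW.
  rewrite zE; apply: le_trans (ler_normD _ _) _.
  have hx : `|alpha i 0 - x i 0| <= A + 1.
    apply: le_trans (ler_normB _ _) _; apply: lerD => //.
    by rewrite ger0_norm; case/andP: (x01 i).
  have : A + 1 <= (A + 1) * T by rewrite ler_peMr// addr_ge0.
  by rewrite /Y; move: hx hz; nra.
apply: (@le_trans _ _ (((2 * (Num.truncn (Y * T)).+1).+1 ^ n)%:R)).
  by rewrite ler_nat; exact: card_box_le.
rewrite natrX lerXn2r ?nnegrE//; first by rewrite mulr_ge0//; lra.
rewrite -natr1 natrM -natr1.
have : (Num.truncn (Y * T))%:R <= Y * T by rewrite truncn_le.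
by nra.
Qed.

(** The cube has measure 1, so P <= p + eps and p <= P + eps can be integrated; in this form all
    integrands are nonnegative. *)
Lemma unit_cube_mean (P : tupleR -> R) (p eps I : R) :
  measurable_fun (@unit_cube R n) (EFin \o P) ->
  (forall s, 0 <= P s) -> 0 <= p -> 0 <= eps ->
  (forall s, @unit_cube R n s -> `|P s - p| <= eps) ->
  (\int[tuple_lebesgue R n]_(s in @unit_cube R n) (P s)%:E = I%:E)%E ->
  `|p - I| <= eps.
Proof.
move=> mP P0 p0 eps0 Pp mean.
have mcube := @measurable_unit_cube R n.
have icst (c : R) : (\int[tuple_lebesgue R n]_(s in @unit_cube R n) c%:E = c%:E)%E.
  rewrite integral_cst//; transitivity (c%:E * 1)%E; last by rewrite mule1.
  by congr (_ * _)%E; exact: unit_cube_measure.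
pose nu := tuple_lebesgue R n; pose cube := @unit_cube R n.
have up : (\int[nu]_(s in cube) (P s)%:E <= \int[nu]_(s in cube) (p + eps)%:E)%E.
  apply: ge0_le_integral => //; rewrite -/cube.
  - by move=> s _; rewrite lee_fin.
  - move=> s sc; rewrite lee_fin.
    by have := Pp s sc; rewrite ler_distl => /andP[]; lra.
have lo : (\int[nu]_(s in cube) p%:E <=
    \int[nu]_(s in cube) ((P s)%:E + eps%:E))%E.
  apply: ge0_le_integral => //; rewrite -/cube.
  - exact: emeasurable_funD.
  - move=> s sc; rewrite -EFinD lee_fin.
    by have := Pp s sc; rewrite ler_distl => /andP[]; lra.
rewrite ge0_integralD// in lo; last by move=> s _; rewrite lee_fin.
rewrite !icst mean -EFinD !lee_fin in up lo.
by rewrite ler_distl; apply/andP; split; lra.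
Qed.

Context (d X : R) (g : R -> R).
Hypotheses (d0 : 0 < d) (g0 : forall u, 0 <= g u) (sg : forall k, bump d X k g).

(** Taking square roots needs T (u + th) >= 0, which holds on the support of g; elsewhere both sides
    are 0. *)
Lemma shifted_count_weight (q T th u : R) : 0 <= q -> 0 < T -> 0 <= th ->
  (q <= (T * (u + th)) ^+ 2)%R%:R * g u =
  (Num.sqrt q / T - th <= u)%R%:R * g u.
Proof.
move=> q0 T0 th0.
have [/andP[du _]|uoff] := pselect (d <= u <= X); last first.
  by rewrite (bump0 (sg 0) uoff) !mulr0.
have u0 : 0 <= T * (u + th).
  by apply: mulr_ge0; [exact: ltW|have := lt_le_trans d0 du; lra].
congr (_%:R * _); congr nat_of_bool.
rewrite lerBlDr ler_pdivrMr// [_ * T]mulrC.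
rewrite -(ler_sqrt _ (sqr_ge0 _)) sqrtr_sqr ger0_norm//.
Qed.

Lemma integral_count (S : {fset 'cV[int]_n}) (s : tupleR) (T th : R) :
  0 < T -> 0 <= th ->
  (\int[leb]_u (count_in M alpha S s (T * (u + th)) * g u)%:E =
   (\sum_(m <- S)
      tail g (Num.sqrt (quadform M (lattice_point alpha m s)) / T - th))%:E)%E.
Proof.
move=> T0 th0.
under eq_integral => u _.
  rewrite /count_in mulr_suml -sumEFin.
  under eq_bigr do rewrite shifted_count_weight ?quadform_ge0//.
  over.
have mg := bump_measurable (sg 1).
rewrite ge0_integral_sum//; last 2 first.
- move=> m; apply/measurable_EFinP; apply: measurable_funM => //.
  by apply: measurable_le_indicator => //; exact: measurable_cst.
- by move=> m u _; rewrite lee_fin mulr_ge0.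
by rewrite -sumEFin; apply: eq_bigr => m _; exact: (integral_ge_tail (sg 1)).
Qed.

Lemma measurable_count (S : {fset 'cV[int]_n}) t :
  measurable_fun setT (fun s : tupleR => count_in M alpha S s t).
Proof.
apply: measurable_sum => m; apply: measurable_le_indicator => //.
exact: measurable_quadform.
Qed.

Lemma cube_average_integral (S : {fset 'cV[int]_n}) (T th : R) :
  0 < T -> 0 <= th <= 1 ->
  (forall m s, unit_cube s ->
     quadform M (lattice_point alpha m s) <= ((X + 1) * T) ^+ 2 -> m \in S) ->
  (\int[tuple_lebesgue R n]_(s in @unit_cube R n)
     \int[leb]_u (count_in M alpha S s (T * (u + th)) * g u)%:E =
   \int[leb]_u
     (volume (ellipsoid M : set 'cV[R]_n) * (T * (u + th)) ^+ n * g u)%:E)%E.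
Proof.
move=> T0 /andP[th0 th1] hS.
(* The indicator of the cube moves into the integrand, so that Tonelli applies on the whole product
   space. *)
pose f (p : tupleR * measurableTypeR R) : \bar R :=
  (\1_(@unit_cube R n) p.1 * (count_in M alpha S p.1 (T * (p.2 + th)) * g p.2))%:E.
have mcube := @measurable_unit_cube R n.
have mg := bump_measurable (sg 1).
have count0 s t : 0 <= count_in M alpha S s t by apply: sumr_ge0 => m _.
have f0 p : (0 <= f p)%E by rewrite lee_fin !mulr_ge0.
have mf : measurable_fun setT f.
  apply/measurable_EFinP; apply: measurable_funM.
    have m1 : measurable_fun setT (\1_(@unit_cube R n) : tupleR -> R).
      exact: measurable_indic.
    exact: (measurableT_comp m1 measurable_fst).
  apply: measurable_funM; last exact: (measurableT_comp mg measurable_snd).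
  apply: measurable_sum => m; apply: measurable_le_indicator.
    exact: (measurableT_comp (measurable_quadform M _) measurable_fst).
  apply: measurable_funX; apply: measurable_funM => //.
  by apply: measurable_funD => //; exact: measurable_snd.
transitivity (\int[tuple_lebesgue R n]_s \int[leb]_u f (s, u))%E.
  rewrite integral_mkcond; apply: eq_integral => s _; rewrite patchE.
  rewrite /f /= indicE; case: ifP => _.
    by under [RHS]eq_integral do rewrite mul1r.
  by under [RHS]eq_integral do rewrite mul0r; rewrite integral0.
rewrite (fubini_tonelli f)//; apply: eq_integral => u _.
transitivity (\int[tuple_lebesgue R n]_(s in @unit_cube R n)
    ((g u)%:E * (count_in M alpha S s (T * (u + th)))%:E))%E.
  rewrite [RHS]integral_mkcond; apply: eq_integral => s _; rewrite patchE.
  rewrite /f /= indicE; case: ifP => _; last by rewrite mul0r.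
  by rewrite mul1r mulrC.
rewrite ge0_integralZl_EFin//; last 2 first.
- by move=> s _; rewrite lee_fin.
- apply/measurable_EFinP; apply: measurable_funTS; exact: measurable_count.
have [/andP[du uX]|uoff] := pselect (d <= u <= X); last first.
  by rewrite (bump0 (sg 0) uoff) mul0e mulr0.
have u0 : 0 < u := lt_le_trans d0 du.
rewrite (cube_average_count hM)//.
- by rewrite -EFinM mulrC.
- by rewrite mulr_gt0//; lra.
- move=> m s sc h; apply: (hS m s sc); apply: le_trans h _.
  rewrite lerXn2r ?nnegrE ?mulr_ge0//; try lra.
  by rewrite mulrC ler_wpM2r//; lra.
Qed.

(** At shift 0 the smoothed sum is the smoothed count, and its mean over the cube is the volume
    integral, so the discrepancy is at most the oscillation over the cube. Integrability is recorded
    because the final estimates subtract and scale these integrals. *)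
Lemma smoothed_discrepancy (K : nat) : exists2 C : R, 0 <= C &
  forall T th : R, 1 <= T -> 0 <= th <= 1 ->
    let D u := (lattice_count M alpha (T * (u + th)))%:R -
      volume (ellipsoid M : set 'cV[R]_n) * (T * (u + th)) ^+ n in
    leb.-integrable setT (fun u => (D u * g u)%:E) /\
    `|\int[leb]_u (D u * g u)| <= C * T^-1 ^+ K.
Proof.
have [C1 C10 hC1] := lattice_box X.
(* Of the n + K + 1 powers of 1/T gained, n pay for the (C1 T)^n terms, K remain and one is
   discarded. *)
have [B B0 hB] := smoothed_sum_cube alpha hM (tail_smooth (sg 1) (sg (n + K)) d0).
exists (C1 ^+ n * B); first by rewrite mulr_ge0// exprn_ge0.
move=> T th T1 th01 D; have T0 : 0 < T by exact: lt_le_trans T1.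
have [L hL cardL] := hC1 T T1.
pose S := box n L.+1.
have hLS (m : 'cV[int]_n) (x : 'cV[R]_n) : (forall i, 0 <= x i 0 <= 1) ->
    quadform M (map_mx intr m - alpha + x) <= ((X + 1) * T) ^+ 2 -> m \in S.
  move=> x01 /(hL m x x01)/in_boxP h; apply/in_boxP => i; have := h i; lia.
have hS m s : @unit_cube R n s ->
    quadform M (lattice_point alpha m s) <= ((X + 1) * T) ^+ 2 -> m \in S.
  move=> s01; apply: hLS => i; rewrite mxE; have := s01 i; rewrite /= in_itv/=.
  by case/andP => -> /ltW ->.
pose V := volume (ellipsoid M : set 'cV[R]_n).
have V0 : 0 <= V by apply: fine_ge0.
have mg := bump_measurable (sg 1).
have [Bg Bg0 hBg] := bump_bounded (sg 0).
pose Q u := V * (T * (u + th)) ^+ n.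
have iQ : leb.-integrable setT (EFin \o (fun u => Q u * g u)).
  apply: (@compact_support_integrable R d X _ (V * (`|X + 1| * T) ^+ n * Bg)).
  - apply: measurable_funM => //; apply: measurable_funM => //.
    apply: measurable_funX; apply: measurable_funM => //.
    exact: measurable_funD.
  - move=> u; have [/andP[du uX]|uoff] := pselect (d <= u <= X); last first.
      rewrite (bump0 (sg 0) uoff) mulr0 normr0 mulr_ge0// mulr_ge0//.
      by rewrite exprn_ge0// mulr_ge0// ltW.
    rewrite normrM; apply: ler_pM => //.
    rewrite normrM (ger0_norm V0) normrX ler_wpM2l// lerXn2r ?nnegrE//.
      by rewrite mulr_ge0// ltW.
    have u0 := lt_le_trans d0 du; have := ler_norm (X + 1).
    by rewrite normrM (gtr0_norm T0) mulrC ler_pM2r// ger0_norm; lra.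
  - by move=> u uoff; rewrite (bump0 (sg 0) uoff) mulr0.
pose s0 : tupleR := [tuple 0 | i < n].
have vs0 : vec s0 = 0 by apply/colP => i; rewrite !mxE tnth_mktuple.
pose N u := (lattice_count M alpha (T * (u + th)))%:R : R.
have NE u : N u * g u = count_in M alpha S s0 (T * (u + th)) * g u.
  have [/andP[du uX]|uoff] := pselect (d <= u <= X); last first.
    by rewrite (bump0 (sg 0) uoff) !mulr0.
  have u0 := lt_le_trans d0 du.
  rewrite /N (@lattice_countE _ _ _ _ _ S); last first.
    move=> m h; apply: (hLS m 0) => [i|]; first by rewrite mxE lexx ler01.
    rewrite addr0; apply: le_trans h _; rewrite [_ * T]mulrC.
    by rewrite lerXn2r ?nnegrE ?mulr_ge0 ?ler_pM2l//; lra.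
  congr (_ * _); apply: eq_bigr => m _; congr (_%:R); congr nat_of_bool.
  by rewrite /lattice_point vs0 addr0.
pose P x := smoothed_sum M alpha (tail g) T th L x.
have PE s : (\int[leb]_u (count_in M alpha S s (T * (u + th)) * g u)%:E =
    (P (vec s))%:E)%E.
  by rewrite integral_count//; case/andP: th01.
have iN : leb.-integrable setT (EFin \o (fun u => N u * g u)).
  apply: (@compact_support_integrable R d X _ ((size S)%:R * Bg)).
  - rewrite (_ : (fun u => _) = fun u => count_in M alpha S s0 (T * (u + th)) * g u).
      apply: measurable_funM => //; apply: measurable_sum => m.
      apply: measurable_le_indicator => //; apply: measurable_funX.
      by apply: measurable_funM => //; exact: measurable_funD.
    by apply/funext => u; exact: NE.
  - move=> u; rewrite NE normrM; apply: ler_pM => //.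
    apply: le_trans (ler_norm_sum _ _ _) _.
    apply: (@le_trans _ _ (\sum_(m <- S) 1)).
      by apply: ler_sum => m _; rewrite normr_nat lern1; exact: leq_b1.
    by rewrite big_const_seq count_predT iter_addr addr0.
  - by move=> u uoff; rewrite (bump0 (sg 0) uoff) mulr0.
have NP : \int[leb]_u (N u * g u) = P 0.
  rewrite /Rintegral; under eq_integral do rewrite NE.
  by rewrite PE vs0.
have DE u : D u * g u = N u * g u - Q u * g u by rewrite mulrBl.
split.
  have := integrableB measurableT iN iQ; apply: eq_integrable => // u _.
  by rewrite DE EFinB.
under eq_Rintegral do rewrite DE.
rewrite RintegralB// NP.
pose eps := C1 ^+ n * B * T^-1 ^+ K.
have eps0 : 0 <= eps by rewrite !mulr_ge0 ?exprn_ge0// invr_ge0 ltW.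
have Posc s : @unit_cube R n s -> `|P (vec s) - P 0| <= eps.
  move=> sc; apply: le_trans (hB T th L (vec s) T0 th01 hL _) _.
    move=> i; rewrite mxE; have := sc i; rewrite /= in_itv/=.
    by case/andP => -> /ltW ->.
  rewrite /eps.
  have Ti1 : T^-1 ^+ K.+1 <= T^-1 ^+ K.
    rewrite exprS ger_pMl ?exprn_gt0 ?invr_gt0//.
    by rewrite invf_le1.
  apply: le_trans (_ : (C1 * T) ^+ n * B * T^-1 ^+ (n + K).+1 <= _).
    by rewrite ler_wpM2r ?exprn_ge0 ?invr_ge0 ?(ltW T0)// ler_wpM2r.
  rewrite -addnS exprD exprMn.
  rewrite (_ : _ * _ = C1 ^+ n * B * ((T * T^-1) ^+ n * T^-1 ^+ K.+1)); last first.
    by rewrite exprMn; ring.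
  by rewrite mulfV ?gt_eqF// expr1n mul1r ler_wpM2l// mulr_ge0// exprn_ge0.
have mean : (\int[tuple_lebesgue R n]_(s in @unit_cube R n) (P (vec s))%:E =
    (\int[leb]_u (Q u * g u))%:E)%E.
  under eq_integral do rewrite -PE.
  rewrite cube_average_integral// /Rintegral fineK//.
  by apply: integrable_fin_num.
have P0 s : 0 <= P (vec s).
  rewrite -lee_fin -PE; apply: integral_ge0 => u _.
  by rewrite lee_fin mulr_ge0// sumr_ge0.
have mP : measurable_fun (@unit_cube R n) (fun s => (P (vec s))%:E).
  have mtail : measurable_fun setT (tail g).
    apply: continuous_measurable_fun => v.
    apply/differentiable_continuous/derivable1_diffP.
    by have [] := is_derive_tail (sg 1) v.
  apply/measurable_EFinP; apply: measurable_funTS; apply: measurable_sum => m.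
  apply: (measurableT_comp mtail); apply: measurable_funB => //.
  apply: measurable_funM => //.
  apply: (measurableT_comp _ (measurable_quadform M _)).
  by apply: continuous_measurable_fun; exact: sqrt_continuous.
have P00 : 0 <= P 0 by rewrite -vs0.
exact: (@unit_cube_mean (fun s => P (vec s)) (P 0) eps _ mP P0 P00 eps0 Posc mean).
Qed.

End discrepancy.

(** * Rescaling the average and the limits *)

Lemma averaging_density_support (R : realType) (mu : R -> R) :
  averaging_density mu ->
  exists2 d : R, 0 < d & exists X : R, forall u, ~ (d <= u <= X) -> mu u = 0.
Proof.
case=> _ _ cmu mu0 _.
have sub u : mu u != 0 -> tsupport mu u by move=> muu; exact: subset_closure.
(* The minimum and maximum of a nonempty support serve as d and X; an empty one is served by d = X =
   1. *)
have [S0|/set0P/negP/negPn/eqP S0] := pselect (tsupport mu !=set0); last first.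
  exists 1 => //; exists 1 => u _; apply/eqP/negPn/negP => /sub.
  by rewrite S0.
have cid : {within tsupport mu, continuous (@id R)}.
  by apply: continuous_subspaceT => x; exact: cvg_id.
have [c cS hc] := compact_EVT_min S0 cmu cid.
have [e eS he] := compact_EVT_max S0 cmu cid.
exists c; first exact/mu0/set_mem.
exists e => u uoff; apply/eqP/negPn/negP => /sub uS; apply: uoff.
by rewrite hc ?he ?inE.
Qed.

Lemma average_rescale (R : realType) (mu f h : R -> R) (T : R) : 0 < T ->
  lebesgue_measure.-integrable setT (EFin \o h) ->
  (forall u, f (T * u) * mu u = h u) ->
  average mu f T = \int[lebesgue_measure]_u h u.
Proof.
move=> T0 ih fh; have Tn0 : T != 0 by rewrite gt_eqF.
have mh : measurable_fun setT (EFin \o h) by case/integrableP: ih.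
pose F t := (T^-1 * h (T^-1 * t + 0))%:E.
have mF : measurable_fun setT F.
  apply/measurable_EFinP; apply: measurable_funM => //.
  apply: (measurableT_comp (f := h)); first exact/measurable_EFinP.
  exact: measurable_affine.
rewrite /average /Rintegral; congr fine.
transitivity (\int[lebesgue_measure]_t F t)%E.
  apply: eq_integral => t _; rewrite /F addr0 -fh mulVKf// [t / T]mulrC.
  by congr EFin; ring.
rewrite -(integral_affine 0 T0 mF).
transitivity (T%:E * \int[lebesgue_measure]_x (T^-1%:E * (h x)%:E))%E.
  congr (_ * _)%E; apply: eq_integral => x _.
  by rewrite /F !addr0 mulKf// EFinM.
by rewrite integralZl// muleA -EFinM mulfV// mul1e.
Qed.

Lemma cvg0_of_bound (R : realType) (a : R -> R) (C : R) :
  (\forall T \near +oo, `|a T| <= C * T^-1) -> a T @[T --> +oo] --> (0 : R).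
Proof.
move=> aC; apply/cvgr0Pnorm_le => e e0.
near=> T; have T0 : 0 < T by near: T; exact: nbhs_pinfty_gt.
apply: (@le_trans _ _ (C * T^-1)); first by near: T.
rewrite ler_pdivrMr//.
by rewrite mulrC -ler_pdivrMr//; near: T; exact: nbhs_pinfty_ge.
Unshelve. all: by end_near. Qed.

(** An integer exponent N >= L leaves room to spare: T^(-2N) <= T^(-N) <= T^(-L) < eta. *)
Lemma sqrt_scale_inv (R : realType) (L T eta : R) : 1 <= T -> T `^ (- L) < eta ->
  (Num.sqrt eta)^-1 <= T ^+ (Num.truncn `|L|).+1.
Proof.
move=> T1 hT; set N := (Num.truncn `|L|).+1.
have T0 : 0 < T by exact: lt_le_trans T1.
have eta0 : 0 < eta by exact: le_lt_trans (powR_ge0 _ _) hT.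
have LN : L <= N%:R by apply: le_trans (ler_norm L) _; rewrite ltW// truncnS_gt.
rewrite -[leRHS]invrK lef_pV2 ?posrE ?sqrtr_gt0 ?invr_gt0 ?exprn_gt0//.
rewrite -[leLHS]ger0_norm ?invr_ge0 ?exprn_ge0 ?(ltW T0)// -sqrtr_sqr.
rewrite ler_sqrt ?(ltW eta0)//; apply: le_trans (ltW hT).
apply: (@le_trans _ _ (T ^+ N)^-1).
  rewrite expr2 ger_pMl ?invr_gt0 ?exprn_gt0// invf_le1 ?exprn_gt0//.
  by rewrite exprn_ege1.
rewrite -powR_invn ?(ltW T0)// ler_powR//.
by rewrite lerN2.
Qed.

Theorem theorem1p2 (R : realType) (mu : R -> R) (hmu : averaging_density mu)
    (n : nat) (hn : (2 <= n)%N) (alpha : 'cV[R]_n)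
    (M : 'M[int]_n) (hM : posdef_sym R M) :
  average mu (FM M alpha) T @[T --> +oo] --> (0 : R)
  /\
  (forall eta : R -> R,
    (exists L C : R, [/\ 0 < L, 0 < C &
       \forall T \near +oo, T `^ (- L) < eta T /\ eta T <= C]) ->
    average mu (fun t => SM M alpha t (eta T)) T @[T --> +oo] --> (0 : R)).
Proof.
have [d d0 [X muX]] := averaging_density_support hmu.
case: (hmu) => mu0 smu _ _ _.
pose s : R := (n%:R - 1) / 2.
have s0 : 0 <= s by rewrite divr_ge0// subr_ge0 ler1n; exact: ltnW.
(* At t = T u the normalisation t^(-s) splits into T^(-s), which is at most 1 for T >= 1, and
   u^(-s), which joins the weight. *)
pose g u := u `^ (- s) * mu u.
have g0 u : 0 <= g u by rewrite mulr_ge0// powR_ge0.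
have sg k : bump d X k g by exact: (bump_powR_mul k 0 (- s) d0 smu muX).
pose V := volume (ellipsoid M : set 'cV[R]_n).
pose D t := (lattice_count M alpha t)%:R - V * t ^+ n.
have weight T u : 0 < T -> mu u / (T * u) `^ s = T `^ (- s) * g u.
  move=> T0; rewrite /g.
  have [/andP[du _]|/muX->] := pselect (d <= u <= X); last first.
    by rewrite mul0r !mulr0.
  rewrite -powRN powRM ?(ltW T0)//; first by ring.
  exact/ltW/(lt_le_trans d0).
have Ts1 T : 1 <= T -> T `^ (- s) <= 1.
  move=> T1; rewrite powRN invf_le1 ?powR_gt0//; last exact: lt_le_trans T1.
  by rewrite -[leLHS](powRr0 T) ler_powR.
split.
  have [C C0 hC] := smoothed_discrepancy alpha hM d0 g0 sg 1.
  apply: (@cvg0_of_bound _ _ C); near=> T.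
  have T1 : 1 <= T by near: T; exact: nbhs_pinfty_ge.
  have T0 : 0 < T by exact: lt_le_trans T1.
  have th0 : 0 <= (0 : R) <= 1 by rewrite lexx ler01.
  have [iD hD] := hC T 0 T1 th0.
  rewrite (@average_rescale _ _ _ (fun u => T `^ (- s) * (D (T * (u + 0)) * g u)))//.
  - rewrite RintegralZl// normrM ger0_norm ?powR_ge0//.
    rewrite -[leRHS]mul1r; apply: ler_pM => //; [exact: powR_ge0|exact: Ts1].
  - exact: (integrableZl measurableT (T `^ (- s)) iD).
  - move=> u; rewrite addr0 mulrCA -weight// /FM -/s -/V -/(D _).
    by rewrite mulrAC -mulrA.
move=> eta [L [C [L0 C0 hL]]].
pose N := (Num.truncn `|L|).+1.
(* N powers of 1/T outweigh eta^(-1/2); the extra one gives the limit 0. *)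
have [B B0 hB] := smoothed_discrepancy alpha hM d0 g0 sg N.+1.
apply: (@cvg0_of_bound _ _ (2 * B)); near=> T.
have T1 : 1 <= T by near: T; exact: nbhs_pinfty_ge.
have T0 : 0 < T by exact: lt_le_trans T1.
(* Ensures eta / T <= 1, the admissible range of th. *)
have CT : C <= T by near: T; apply: nbhs_pinfty_ge; exact: num_real.
have [eL eC] : T `^ (- L) < eta T /\ eta T <= C by near: T.
have e0 : 0 < eta T by exact: le_lt_trans (powR_ge0 _ _) eL.
have th0 : 0 <= (0 : R) <= 1 by rewrite lexx ler01.
have th1 : 0 <= eta T / T <= 1.
  by rewrite divr_ge0 ?(ltW e0) ?(ltW T0)//= ler_pdivrMr// mul1r (le_trans eC).
have [i0 h0] := hB T 0 T1 th0; have [i1 h1] := hB T (eta T / T) T1 th1.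
pose c := (Num.sqrt (eta T))^-1 * T `^ (- s).
(* As t + eta = T (u + eta / T), the numerator of S_M is the difference of the discrepancies for th
   = eta / T and th = 0; hence the factor 2 in the bound. *)
rewrite (@average_rescale _ _ _ (fun u => c *
    (D (T * (u + eta T / T)) * g u - D (T * (u + 0)) * g u)))//.
- rewrite RintegralZl//; last exact: (integrableB measurableT i1 i0).
  rewrite RintegralB// normrM ger0_norm; last first.
    by rewrite mulr_ge0 ?powR_ge0// invr_ge0 sqrtr_ge0.
  apply: (@le_trans _ _ (T ^+ N * (2 * B * T^-1 ^+ N.+1))).
    apply: ler_pM => //.
    + by rewrite mulr_ge0 ?powR_ge0// invr_ge0 sqrtr_ge0.
    + rewrite -[leRHS]mulr1 ler_pM ?invr_ge0 ?sqrtr_ge0 ?powR_ge0 ?Ts1//.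
      exact: sqrt_scale_inv eL.
    + by apply: le_trans (ler_normB _ _) _; rewrite -mulrA mulr2n mulrDl mul1r lerD.
  rewrite exprS (_ : _ * _ = 2 * B * T^-1 * (T * T^-1) ^+ N); last first.
    by rewrite exprMn; ring.
  by rewrite mulfV ?gt_eqF// expr1n mulr1.
- exact: (integrableZl measurableT c (integrableB measurableT i1 i0)).
- move=> u; have -> : T * (u + eta T / T) = T * u + eta T by field; rewrite gt_eqF.
  rewrite addr0 -mulrBl /c -mulrA [T `^ _ * _]mulrCA -weight// /SM -/s -/V /D.
  by rewrite invfM; ring.
Unshelve. all: by end_near. Qed.
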